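(* Let $a_n\to\infty$ be a sequence of positive numbers, and let $(X_n)_{n\in\mathbb{N}}$ be a sequence of random matrices with $X_n\in M_n^{sa}$ such that $X_n\in\mathcal{S}(d_n)$ for every $n$ with $d_n=O(n^2/a_n^2)$. Assume $(X_n)_{n\in\mathbb{N}}$ has property $\mathcal{L}(a_n)$. Then for every $f\in C_c(\mathbb{R})\cap C_L(\mathbb{R})$, \[ \int f\,dL_n^{\frac1{\sqrt n}X_n}-\mathbb{E}\int f\,dL_n^{\frac1{\sqrt n}X_n}\to0\quad\text{in probability}. \]
   Context: $M_n^{sa}$ denotes the space of $n\times n$ complex Hermitian matrices. For a random Hermitian $n\times n$ matrix $X$ with eigenvalues $\lambda_1\le\dots\le\lambda_n$, $L_n^X=\frac1n\sum_{i=1}^n\delta_{\lambda_i}$. A random $n\times m$ matrix $X$ satisfies $\mathcal{S}(d)$ if there is a partition $\{P_1,\dots,P_k\}$ of $\{1,\dots,n\}\times\{1,\dots,m\}$ such that the random vectors $\{X_{ij}\}_{(i,j)\in P_r}$, $r=1,\dots,k$, are mutually independent and $|P_r|\le d$ for all $r$. A sequence of random matrices $X_n\in M_n$ has property $\mathcal{L}(a_n)$ if for every $\varepsilon>0$, \[ \limsup_{n\to\infty}\mathbb{P}\Big(\frac1{n^2}\sum_{i,j=1}^n|(X_n)_{ij}|^2\mathbf{1}_{\{|(X_n)_{ij}|>\varepsilon a_n\}}>\varepsilon\Big)=0. \] $C_c(\mathbb{R})$ denotes real compactly supported continuous functions, $C_L(\mathbb{R})$ real 1-Lipschitz functions on $\mathbb{R}$.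 *)

(* Defs.v *)
From HB Require Import structures.
From mathcomp Require Import all_boot all_order all_algebra.
From mathcomp Require Import complex.
From mathcomp Require Import all_classical all_reals all_analysis.

Set Implicit Arguments.
Unset Strict Implicit.
Unset Printing Implicit Defensive.

Import Order.TTheory GRing.Theory Num.Theory.
Import numFieldNormedType.Exports.

Local Open Scope classical_set_scope.
Local Open Scope ring_scope.

Definition cmod (R : realType) (z : R[i]) : R :=
  Num.sqrt (complex.Re z ^+ 2 + complex.Im z ^+ 2).

Definition herm_mx (R : realType) (n : nat) (A : 'M[R[i]]_n) : Prop :=
  forall i j : 'I_n, A j i = conjc (A i j).

(* the eigenvalues of A, with multiplicity: the roots of its characteristic
   polynomial (which splits over the algebraically closed field R[i]) *)
Definition eigs (R : realType) (n : nat) (A : 'M[R[i]]_n) : seq R[i] :=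
  sval (closed_field_poly_normal (char_poly A)).

(* \int f dL_n^A = (1/n) \sum_i f(lambda_i); for Hermitian A the eigenvalues
   are real, so lambda_i = Re lambda_i *)
Definition esd_int (R : realType) (n : nat) (f : R -> R) (A : 'M[R[i]]_n) : R :=
  n%:R^-1 * \sum_(z <- eigs A) f (complex.Re z).

Definition esd_stat (d : measure_display) (T : measurableType d) (R : realType)
  (f : R -> R) (X : forall n : nat, T -> 'M[R[i]]_n) (n : nat) (w : T) : R :=
  esd_int f ((real_complex R (Num.sqrt n%:R)^-1) *: X n w).

Definition block_sigma (d : measure_display) (T : measurableType d) (R : realType)
  (n : nat) (X : T -> 'M[R[i]]_n) (B : set ('I_n * 'I_n)) : set (set T) :=
  <<s [set E | exists (i j : 'I_n), B (i, j) /\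
        exists A : set R, measurable A /\
          (E = (fun w => complex.Re (X w i j)) @^-1` A \/ E = (fun w => complex.Im (X w i j)) @^-1` A)] >>.

(* property S(dd): a partition of the index set into blocks (given by a
   labelling part : 'I_n x 'I_n -> 'I_K) of size <= dd, such that the random
   vectors (X_ij)_{(i,j) in block r} are mutually independent *)
Definition property_S (d : measure_display) (T : measurableType d) (R : realType)
  (P : probability T R) (n : nat) (X : T -> 'M[R[i]]_n) (dd : nat) : Prop :=
  exists (K : nat) (part : 'I_n -> 'I_n -> 'I_K),
    (forall r : 'I_K, #|[set ij : 'I_n * 'I_n | part ij.1 ij.2 == r]| <= dd)%N /\
    (forall A : 'I_K -> set T,
        (forall r, block_sigma X [set ij | part ij.1 ij.2 = r] (A r)) ->
        P (\bigcap_(r in [set: 'I_K]) A r) = (\prod_(r < K) P (A r))%E).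

Definition property_L (d : measure_display) (T : measurableType d) (R : realType)
  (P : probability T R) (X : forall n : nat, T -> 'M[R[i]]_n) (a : nat -> R) : Prop :=
  forall eps : R, 0 < eps ->
    limn_esup (fun n => P [set w | eps < n%:R ^- 2 *
        \sum_(i < n) \sum_(j < n)
           cmod (X n w i j) ^+ 2 * (if eps * a n < cmod (X n w i j) then 1 else 0)]) = 0%E.

(* Main.v *)
(** Only concentration of [X |-> (1/n) tr h(X / sqrt n)] for [h y = |y - t|] is needed,
    since a compactly supported Lipschitz [f] is a uniform limit of functions
    [c + sum_q u_q |y - t_q|].  Such a trace function is convex in the entries: by the
    spectral theorem and double stochasticity it has subgradients of squared norm at most
    [1 / n^2] (Klein's inequality).

    Truncate the entries at [e a_n] and round them to a finite grid.  Property L makes the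
    induced change of the statistic small with high probability.  The rounded matrix is
    finitely valued and its blocks are still independent, so the Efron-Stein inequality
    becomes a statement about finite sums; inserting the subgradients, the variance is at
    most (squared diameter of a block) / n^2 = O((e a_n)^2 d_n / n^2) = O(e^2).  Without
    convexity the bound would be O(e^2 a_n^2) only.  Chebyshev's inequality concludes. *)

Require Import Defs.
From HB Require Import structures.
From mathcomp Require Import all_boot all_order all_algebra.
From mathcomp Require Import complex.
From mathcomp Require Import all_classical all_reals all_analysis.
From mathcomp Require Import spectral sesquilinear measurable_realfun.
From mathcomp Require Import ring lra.

Import Order.TTheory GRing.Theory Num.Theory.
Import numFieldNormedType.Exports.

Local Open Scope classical_set_scope.
Local Open Scope ring_scope.

Set Implicit Arguments.
Unset Strict Implicit.

(** * Convexity of traces of functions of Hermitian matrices *)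

Section HermitianTrace.
Variable R : realType.
Local Notation C := R[i].
Implicit Types n : nat.
Local Open Scope sesquilinear_scope.

Lemma herm_mx_hermsym n (A : 'M[C]_n) : herm_mx A -> A \is hermsymmx.
Proof.
move=> hA; apply/is_hermitianmxP; rewrite expr0 scale1r.
by apply/matrixP => i j; rewrite !mxE (hA i j); apply/esym/conjcK.
Qed.

Lemma herm_mx_spectral n (A : 'M[C]_n) : herm_mx A ->
  A = (spectralmx A)^t* *m diag_mx (spectral_diag A) *m spectralmx A.
Proof.
move=> /herm_mx_hermsym /hermitian_normalmx /orthomx_spectralP.
by rewrite invmx_unitary ?spectral_unitarymx.
Qed.

Lemma char_poly_similar n (Q D P : 'M[C]_n) : Q *m P = 1%:M ->
  char_poly (Q *m D *m P) = char_poly D.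
Proof.
move=> QP; have PQ : P *m Q = 1%:M by apply: mulmx1C.
have QP1 : map_mx polyC Q *m map_mx polyC P = 1%:M.
  by rewrite -map_mxM QP map_mx1.
rewrite /char_poly; have -> : char_poly_mx (Q *m D *m P) =
    map_mx polyC Q *m char_poly_mx D *m map_mx polyC P.
  rewrite /char_poly_mx mulmxBr mulmxBl !map_mxM; congr (_ - _).
  by rewrite -scalemx1 -scalemxAr -scalemxAl mulmx1 QP1.
rewrite !det_mulmx mulrC mulrA -det_mulmx.
by rewrite -map_mxM PQ map_mx1 det1 mul1r.
Qed.

(** Unitary conjugation preserves the characteristic polynomial, so both lists are its roots with
    multiplicity, and unique factorisation identifies them. This links the algebraic eigenvalues to
    the spectral theorem. *)
Lemma perm_eigs_spectral_diag n (A : 'M[C]_n) : herm_mx A ->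
  perm_eq (eigs A) [seq spectral_diag A 0 i | i <- enum 'I_n].
Proof.
move=> hA; rewrite /eigs; case: closed_field_poly_normal => s /= sE.
apply: prod_XsubC_eq.
rewrite (monicP (char_poly_monic A)) scale1r in sE; rewrite -sE.
rewrite {1}(herm_mx_spectral hA) char_poly_similar; last first.
  by apply: mulmx1C; apply/unitarymxP; apply: spectral_unitarymx.
rewrite char_poly_trig ?diag_mx_is_trig// big_map big_enum/=.
by apply: eq_bigr => i _; rewrite !mxE eqxx mulr1n.
Qed.

Definition spec_re n (A : 'M[C]_n) (i : 'I_n) : R :=
  complex.Re (spectral_diag A 0 i).

Lemma sum_eigs n (A : 'M[C]_n) (g : R -> R) : herm_mx A ->
  \sum_(z <- eigs A) g (complex.Re z) = \sum_i g (spec_re A i).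
Proof.
move=> hA; rewrite (perm_big _ (perm_eigs_spectral_diag hA)).
by rewrite big_map big_enum.
Qed.

(** The squared modulus, taken in [R] so that all estimates stay real. *)
Definition sqc (z : C) : R := complex.Re z ^+ 2 + complex.Im z ^+ 2.

Definition cdiag n (u : 'I_n -> R) : 'rV[C]_n := \row_i (u i)%:C%C.

Lemma cdiag_spec_re n (A : 'M[C]_n) : herm_mx A ->
  cdiag (spec_re A) = spectral_diag A.
Proof.
move=> hA; apply/rowP => i; rewrite mxE RRe_real//.
by have /mxOverP := hermitian_spectral_diag_real (herm_mx_hermsym hA); apply.
Qed.

Lemma ReD (x y : C) : complex.Re (x + y) = complex.Re x + complex.Re y.
Proof. by case: x y => [a b] [c e]. Qed.

Lemma Re_sum I (r : seq I) (F : I -> C) :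
  complex.Re (\sum_(i <- r) F i) = \sum_(i <- r) complex.Re (F i).
Proof.
elim/big_ind2: _ => //; by move=> x1 x2 y1 y2 <- <-; rewrite ReD.
Qed.

(** Hermitian symmetry replaces [A j i] by the conjugate of [A i j], which makes the trace the real
    inner product of the entries. *)
Lemma Re_trace_mul n (S A : 'M[C]_n) : herm_mx A ->
  complex.Re (\tr (S *m A)) = \sum_i \sum_j
    (complex.Re (S i j) * complex.Re (A i j) + complex.Im (S i j) * complex.Im (A i j)).
Proof.
move=> hA; rewrite /mxtrace Re_sum; apply: eq_bigr => i _.
rewrite mxE Re_sum; apply: eq_bigr => j _; rewrite (hA i j).
by case: (S i j) (A i j) => [? ?] [? ?] /=; ring.
Qed.

(** By cyclicity of the trace only the overlap matrix [P *m Q^t*] of the two eigenbases matters. *)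
Lemma trace_conj_diag n (P Q : 'M[C]_n) (u v : 'I_n -> R) :
  \tr ((P^t* *m diag_mx (cdiag u) *m P) *m (Q^t* *m diag_mx (cdiag v) *m Q)) =
  (\sum_i \sum_j u i * v j * sqc ((P *m Q^t*) i j))%:C%C.
Proof.
set W := P *m Q^t*.
have Wt : W^t* = Q *m P^t* by rewrite /W trmx_mul map_mxM trmxCK.
transitivity (\tr (P^t* *m (diag_mx (cdiag u) *m (W *m diag_mx (cdiag v) *m Q)))).
  by rewrite /W !mulmxA.
rewrite mxtrace_mulC.
transitivity (\tr (diag_mx (cdiag u) *m (W *m diag_mx (cdiag v) *m W^t*))).
  by rewrite Wt !mulmxA.
move: W Wt => W _; rewrite rmorph_sum /mxtrace; apply: eq_bigr => i _.
rewrite mul_diag_mx !mxE rmorph_sum mulr_sumr.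
apply: eq_bigr => j _.
rewrite mul_mx_diag !mxE !rmorphM/= /sqc add_Re2_Im2 sqr_normc.
by rewrite -[Num.conj (W i j)]/(conjc (W i j)); ring.
Qed.

Lemma unitary_row_sqc n (W : 'M[C]_n) i : W \is unitarymx -> \sum_j sqc (W i j) = 1.
Proof.
move=> /unitarymxP/matrixP/(_ i i); rewrite !mxE eqxx => /(congr1 (@complex.Re R)).
rewrite Re_sum mulr1n /= => <-; apply: eq_bigr => j _; rewrite !mxE /sqc.
by case: (W i j) => a b /=; ring.
Qed.

Lemma unitary_col_sqc n (W : 'M[C]_n) j : W \is unitarymx -> \sum_i sqc (W i j) = 1.
Proof.
rewrite -trmx_unitary => /(unitary_row_sqc j) <-.
by apply: eq_bigr => i _; rewrite mxE.
Qed.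

(* The weights [sqc ((P *m Q^t* ) i j)] form a doubly stochastic matrix; averaging the
   scalar subgradient inequality against it gives Klein's inequality. *)
Lemma sum_eigs_subgradient n (h s : R -> R) (A : 'M[C]_n) :
  (forall x y, h x + s x * (y - x) <= h y) -> (forall x, `|s x| <= 1) ->
  herm_mx A ->
  exists S : 'M[C]_n, \sum_i \sum_j sqc (S i j) <= n%:R /\
    forall B, herm_mx B ->
    \sum_(z <- eigs A) h (complex.Re z) - \sum_(z <- eigs B) h (complex.Re z) <=
    \sum_i \sum_j (complex.Re (S i j) * complex.Re (A i j - B i j) +
                   complex.Im (S i j) * complex.Im (A i j - B i j)).
Proof.
move=> hs s1 hA; set P := spectralmx A.
have uP : P \is unitarymx := spectral_unitarymx A.
(* [S] is [s] applied to [A] by functional calculus, a subgradient of the trace of [h] at [A]. *)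
pose sA i := s (spec_re A i).
pose S := P^t* *m diag_mx (cdiag sA) *m P.
have WA : P *m P^t* = 1%:M by apply/unitarymxP.
have hS : S = S^t*.
  rewrite /S !trmx_mul !map_mxM trmxCK tr_diag_mx map_diag_mx !mulmxA.
  congr (_ *m diag_mx _ *m _); apply/rowP => i; rewrite !mxE.
  by rewrite -[RHS]/(conjc _) conjc_real.
have diagsum (u v : 'I_n -> R) :
    \sum_i \sum_j u i * v j * sqc ((P *m P^t*) i j) = \sum_i u i * v i.
  apply: eq_bigr => i _; rewrite (bigD1 i)//= WA mxE eqxx.
  rewrite big1 => [|j ji]; first by rewrite /sqc/= expr1n expr0n !addr0 mulr1.
  by rewrite mxE eq_sym (negbTE ji) /sqc/= !expr0n/= addr0 mulr0.
exists S; split.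
  (* The squared Frobenius norm is the trace of [S *m S], a sum of [n] squares of values of [s]. *)
  have -> : \sum_i \sum_j sqc (S i j) = complex.Re (\tr (S *m S)).
    rewrite Re_trace_mul; last by move=> i j; rewrite {1}hS !mxE.
    by apply: eq_bigr => i _; apply: eq_bigr => j _; rewrite /sqc !expr2.
  rewrite trace_conj_diag diagsum.
  rewrite (le_trans (_ : _ <= \sum_(i < n) 1))//.
    apply: ler_sum => i _; rewrite -expr2 -real_normK ?num_real//.
    by rewrite expr_le1//; exact: s1.
  by rewrite sumr_const card_ord.
move=> B hB; set Q := spectralmx B.
have uQ : Q \is unitarymx := spectral_unitarymx B.
have -> : \sum_i \sum_j (complex.Re (S i j) * complex.Re (A i j - B i j) +
      complex.Im (S i j) * complex.Im (A i j - B i j)) =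
    complex.Re (\tr (S *m A)) - complex.Re (\tr (S *m B)).
  rewrite !Re_trace_mul// -sumrB; apply: eq_bigr => i _.
  rewrite -sumrB; apply: eq_bigr => j _.
  by case: (S i j) (A i j) (B i j) => [? ?] [? ?] [? ?] /=; ring.
set W := P *m Q^t*.
have -> : \tr (S *m A) = (\sum_i sA i * spec_re A i)%:C%C.
  by rewrite {1}(herm_mx_spectral hA) -(cdiag_spec_re hA) trace_conj_diag diagsum.
have -> : \tr (S *m B) = (\sum_i \sum_j sA i * spec_re B j * sqc (W i j))%:C%C.
  by rewrite {1}(herm_mx_spectral hB) -(cdiag_spec_re hB) trace_conj_diag.
rewrite !sum_eigs//=.
have uW : W \is unitarymx by rewrite mul_unitarymx// trmxC_unitary.
have E1 : \sum_i h (spec_re A i) - \sum_i sA i * spec_re A i =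
    \sum_i \sum_j (h (spec_re A i) - sA i * spec_re A i) * sqc (W i j).
  rewrite -sumrB; apply: eq_bigr => i _.
  by rewrite -mulr_sumr unitary_row_sqc// mulr1.
have E2 : \sum_j h (spec_re B j) = \sum_i \sum_j h (spec_re B j) * sqc (W i j).
  rewrite exchange_big/=; apply: eq_bigr => j _.
  by rewrite -mulr_sumr unitary_col_sqc// mulr1.
suff : \sum_i h (spec_re A i) - \sum_i sA i * spec_re A i +
    \sum_i \sum_j sA i * spec_re B j * sqc (W i j) <= \sum_j h (spec_re B j) by lra.
rewrite E1 E2 -big_split/=.
apply: ler_sum => i _; rewrite -big_split; apply: ler_sum => j _ /=.
rewrite -mulrDl ler_wpM2r//; first by rewrite addr_ge0 ?sqr_ge0.
by have := hs (spec_re A i) (spec_re B j); rewrite /sA; lra.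
Qed.

End HermitianTrace.

(** Convexity with a Lipschitz constant: [s] is a subgradient at [x], phrased as a bound on the drop
    from [x], the form that the one-sided Efron-Stein inequality consumes. *)
Definition has_subgradients (R : realType) (J : finType) (L2 : R)
    (G : (J -> R) -> R) : Prop :=
  forall x, exists s : J -> R, \sum_j s j ^+ 2 <= L2 /\
    forall y, G x - G y <= \sum_j s j * (x j - y j).

(** Lagrange's identity: the defect is half of a double sum of squares. *)
Lemma sum_cauchy_schwarz (R : realType) (I : finType) (D : pred I) (u v : I -> R) :
  (\sum_(i | D i) u i * v i) ^+ 2 <=
  (\sum_(i | D i) u i ^+ 2) * (\sum_(i | D i) v i ^+ 2).
Proof.
have H : 0 <= \sum_(i | D i) \sum_(j | D j) (u i * v j - u j * v i) ^+ 2.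
  by apply: sumr_ge0 => i _; apply: sumr_ge0 => j _; rewrite sqr_ge0.
have E : \sum_(i | D i) \sum_(j | D j) (u i * v j - u j * v i) ^+ 2 =
   2 * ((\sum_(i | D i) u i ^+ 2) * (\sum_(i | D i) v i ^+ 2)) -
   2 * (\sum_(i | D i) u i * v i) ^+ 2.
  have E1 : (\sum_(i | D i) u i ^+ 2) * (\sum_(i | D i) v i ^+ 2) =
      \sum_(i | D i) \sum_(j | D j) u i ^+ 2 * v j ^+ 2 by rewrite big_distrlr.
  have E2 : (\sum_(i | D i) u i ^+ 2) * (\sum_(i | D i) v i ^+ 2) =
      \sum_(i | D i) \sum_(j | D j) u j ^+ 2 * v i ^+ 2.
    by rewrite E1 exchange_big.
  have E3 : (\sum_(i | D i) u i * v i) ^+ 2 =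
      \sum_(i | D i) \sum_(j | D j) (u i * v i) * (u j * v j).
    by rewrite expr2 big_distrlr.
  rewrite [2 * _]mulr_natl mulr2n {1}E1 E2 E3 mulr_sumr -big_split -sumrB.
  apply: eq_bigr => i _ /=; rewrite mulr_sumr -big_split -sumrB.
  by apply: eq_bigr => j _ /=; ring.
by rewrite E in H; lra.
Qed.

(** The claim is symmetric in [x] and [y], so the larger value may be taken at [x]; Cauchy-Schwarz
    then applies to the subgradient there. *)
Lemma subgradients_lipschitz (R : realType) (J : finType) (L2 : R)
    (G : (J -> R) -> R) x y : has_subgradients L2 G ->
  (G x - G y) ^+ 2 <= L2 * \sum_j (x j - y j) ^+ 2.
Proof.
move=> hG; wlog xy : x y / 0 <= G x - G y.
  move=> hw; have [|/ltW lt0] := leP 0 (G x - G y); first exact: hw.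
  rewrite -sqrrN opprB (eq_bigr (fun j => (y j - x j) ^+ 2)); last first.
    by move=> j _; rewrite -sqrrN opprB.
  by apply: hw; lra.
have [s [sL sG]] := hG x.
apply: (@le_trans _ _ ((\sum_j s j * (x j - y j)) ^+ 2)).
  by rewrite ler_pXn2r// nnegrE// (le_trans xy).
rewrite (le_trans (sum_cauchy_schwarz _ _ _))// ler_wpM2r//.
by apply: sumr_ge0 => j _; rewrite sqr_ge0.
Qed.

(** * Real coordinates of Hermitian matrices *)

Section MatrixCoordinates.
Variable R : realType.
Local Notation C := R[i].
Implicit Types n : nat.

Definition entry n : finType := ('I_n * 'I_n * bool)%type.

(* A Hermitian matrix scaled by [1 / sqrt n] from unconstrained real coordinates: the
   symmetrisation allows changing one block of entries without its mirror image. *)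
Definition herm_of n (x : entry n -> R) : 'M[C]_n :=
  \matrix_(i, j) Complex
    ((Num.sqrt n%:R)^-1 * ((x (i, j, false) + x (j, i, false)) / 2))
    ((Num.sqrt n%:R)^-1 * ((x (i, j, true) - x (j, i, true)) / 2)).

Definition coords n (A : 'M[C]_n) (k : entry n) : R :=
  if k.2 then complex.Im (A k.1.1 k.1.2) else complex.Re (A k.1.1 k.1.2).

Lemma herm_of_herm n (x : entry n -> R) : herm_mx (herm_of x).
Proof.
move=> i j; rewrite !mxE /=; congr (Complex _ _); first by rewrite addrC.
by rewrite -[X in X / 2]opprB mulNr mulrN.
Qed.

Lemma herm_of_coords n (A : 'M[C]_n) : herm_mx A ->
  herm_of (coords A) = real_complex R (Num.sqrt n%:R)^-1 *: A.
Proof.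
move=> hA; apply/matrixP => i j; rewrite !mxE /coords/= (hA i j).
set q := (Num.sqrt n%:R)^-1.
by case: (A i j) => a b; apply/eqP; rewrite eq_complex /=; apply/andP; split; apply/eqP; field.
Qed.

Lemma sum_entry n (F : entry n -> R) :
  \sum_k F k = \sum_i \sum_j (F (i, j, false) + F (i, j, true)).
Proof.
transitivity (\sum_(p : 'I_n * 'I_n) \sum_(b : bool) F (p, b)).
  by rewrite pair_big; apply: eq_bigr => -[].
rewrite [RHS]pair_big/=; apply: eq_bigr => -[i j] _.
by rewrite big_bool addrC.
Qed.

Lemma abs_subgradient (t x y : R) :
  `|x - t| + (if t <= x then 1 else -1) * (y - x) <= `|y - t|.
Proof.
case: (leP t x) => tx.
  by rewrite (ger0_norm (x := x - t)) ?subr_ge0//; have := ler_norm (y - t); lra.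
rewrite (ler0_norm (x := x - t)) ?subr_le0 ?(ltW tx)//.
by have := ler_norm (t - y); rewrite (distrC t y); lra.
Qed.

Definition abs_esd n (t : R) (x : entry n -> R) : R :=
  esd_int (fun y => `|y - t|) (herm_of x).

(** Chain rule for the linear map [herm_of]. The factor [1 / n] of the statistic and the scaling
    [1 / sqrt n] contribute [n ^- 3] to the squared norm, and the matrix subgradient contributes at
    most [n]. *)
Lemma abs_esd_subgradients n (t : R) : (0 < n)%N ->
  has_subgradients (n%:R ^- 2) (@abs_esd n t).
Proof.
move=> n0 x; set q := (Num.sqrt n%:R)^-1 : R.
have q2 : q ^+ 2 = n%:R^-1 by rewrite exprVn sqr_sqrtr.
have n0R : (n%:R : R) != 0 by rewrite pnatr_eq0 -lt0n.
have [||S [SL SG]] := @sum_eigs_subgradient R n (fun y => `|y - t|)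
    (fun x => if t <= x then 1 else -1) (herm_of x) _ _ (herm_of_herm x).
- by move=> *; apply: abs_subgradient.
- by move=> y; case: ifP; rewrite ?normrN normr1.
(* The adjoint of the symmetrisation in [herm_of], applied to [S]. *)
pose s (k : entry n) := n%:R^-1 * q *
  (if k.2 then (complex.Im (S k.1.1 k.1.2) - complex.Im (S k.1.2 k.1.1)) / 2
   else (complex.Re (S k.1.1 k.1.2) + complex.Re (S k.1.2 k.1.1)) / 2).
exists s; split.
  apply: (@le_trans _ _ ((n%:R^-1 * q) ^+ 2 * \sum_i \sum_j sqc (S i j))).
    rewrite sum_entry.
    (* Averaging over mirror pairs reduces the norm bound to an entrywise convexity inequality. *)
    have -> : \sum_i \sum_j sqc (S i j) =
        \sum_i \sum_j (sqc (S i j) + sqc (S j i)) / 2.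
      have E : \sum_i \sum_j sqc (S i j) = \sum_i \sum_j sqc (S j i) by exact: exchange_big.
      under [RHS]eq_bigr do rewrite -mulr_suml big_split/=.
      by rewrite -mulr_suml big_split/= -E; field.
    rewrite mulr_sumr; apply: ler_sum => i _; rewrite mulr_sumr; apply: ler_sum => j _.
    rewrite /s/= ![(_ * q * _) ^+ 2]exprMn -mulrDr ler_wpM2l ?sqr_ge0//.
    rewrite /sqc; set a := complex.Re _; set b := complex.Re _.
    set c := complex.Im _; set e := complex.Im _.
    by have := sqr_ge0 (a - b); have := sqr_ge0 (c + e); nra.
  rewrite exprMn q2; apply: le_trans (ler_wpM2l _ SL) _.
    by rewrite mulr_ge0 ?sqr_ge0 ?invr_ge0.
  by rewrite -mulrA mulVf// mulr1 exprVn.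
move=> y; rewrite /abs_esd /esd_int -mulrBr.
apply: le_trans (ler_wpM2l _ (SG _ (herm_of_herm y))) _; first by rewrite invr_ge0.
rewrite sum_entry.
pose u i j := x (i, j, false) - y (i, j, false).
pose v i j := x (i, j, true) - y (i, j, true).
have E1 : \sum_i \sum_j (s (i, j, false) * (x (i, j, false) - y (i, j, false)) +
     s (i, j, true) * (x (i, j, true) - y (i, j, true))) =
   n%:R^-1 * q / 2 * (\sum_i \sum_j (complex.Re (S i j) * u i j + complex.Im (S i j) * v i j)
     + \sum_i \sum_j (complex.Re (S j i) * u i j - complex.Im (S j i) * v i j)).
  rewrite -big_split mulr_sumr; apply: eq_bigr => i _.
  rewrite -big_split mulr_sumr; apply: eq_bigr => j _.
  by rewrite /s /u /v /=; ring.
(* Relabelling the mirror sum moves the symmetrisation from [S] back to [x - y]. *)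
rewrite E1 [X in _ + X]exchange_big/= -big_split -!mulrA ler_wpM2l ?invr_ge0//.
rewrite !mulr_sumr; apply: ler_sum => i _.
rewrite -big_split !mulr_sumr; apply: ler_sum => j _; rewrite !mxE /= -/q /u /v.
by rewrite le_eqVlt; apply/orP; left; apply/eqP; field.
Qed.

End MatrixCoordinates.

(** * The Efron-Stein inequality on a finite product space *)

Section EfronStein.
Variables (R : realType) (V : finType) (K : nat) (p : 'I_K -> V -> R).
Hypothesis p_ge0 : forall r v, 0 <= p r v.
Hypothesis p_sum1 : forall r, \sum_v p r v = 1.
Local Notation pt := {ffun 'I_K -> V}.

Definition wt (y : pt) : R := \prod_r p r (y r).

Definition mean (G : pt -> R) : R := \sum_y wt y * G y.

Definition mean2 (H : pt -> pt -> R) : R := \sum_y \sum_z wt y * wt z * H y z.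

(** The pair [mix D y z], [mix D z y] is [y], [z] with the coordinates in [D] swapped. *)
Definition mix (D : pred 'I_K) (y z : pt) : pt := [ffun r => if D r then z r else y r].

Lemma wt_ge0 y : 0 <= wt y.
Proof. by apply: prodr_ge0 => r _. Qed.

Lemma wt_sum1 : \sum_y wt y = 1.
Proof.
rewrite /wt -(bigA_distr_bigA (fun r v => p r v)).
by rewrite big1.
Qed.

Lemma mean_cst c : mean (fun=> c) = c.
Proof. by rewrite /mean -mulr_suml wt_sum1 mul1r. Qed.

Lemma meanD G1 G2 : mean (fun y => G1 y + G2 y) = mean G1 + mean G2.
Proof. by rewrite /mean -big_split; apply: eq_bigr => y _; rewrite mulrDr. Qed.

Lemma meanZ c G : mean (fun y => c * G y) = c * mean G.
Proof. by rewrite /mean mulr_sumr; apply: eq_bigr => y _; rewrite mulrCA. Qed.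

Lemma mean_le G1 G2 : (forall y, G1 y <= G2 y) -> mean G1 <= mean G2.
Proof. by move=> h; apply: ler_sum => y _; rewrite ler_wpM2l ?wt_ge0. Qed.

Lemma mean2_le H1 H2 : (forall y z, H1 y z <= H2 y z) -> mean2 H1 <= mean2 H2.
Proof.
move=> h; apply: ler_sum => y _; apply: ler_sum => z _.
by rewrite ler_wpM2l ?mulr_ge0 ?wt_ge0.
Qed.

Lemma eq_mean2 H1 H2 : (forall y z, H1 y z = H2 y z) -> mean2 H1 = mean2 H2.
Proof. by move=> h; apply: eq_bigr => y _; apply: eq_bigr => z _; rewrite h. Qed.

Lemma mean2_cst c : mean2 (fun _ _ => c) = c.
Proof.
rewrite /mean2 -[RHS]mul1r -{1}wt_sum1 mulr_suml; apply: eq_bigr => y _.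
by rewrite -mulr_suml -mulr_sumr wt_sum1 mulr1.
Qed.

Lemma mean2D H1 H2 : mean2 (fun y z => H1 y z + H2 y z) = mean2 H1 + mean2 H2.
Proof.
rewrite /mean2 -big_split; apply: eq_bigr => y _; rewrite -big_split.
by apply: eq_bigr => z _; rewrite mulrDr.
Qed.

Lemma mean2Z c H : mean2 (fun y z => c * H y z) = c * mean2 H.
Proof.
rewrite /mean2 mulr_sumr; apply: eq_bigr => y _; rewrite mulr_sumr.
by apply: eq_bigr => z _; rewrite mulrCA.
Qed.

Lemma mean2_sum m (H : 'I_m -> pt -> pt -> R) :
  mean2 (fun y z => \sum_r H r y z) = \sum_r mean2 (H r).
Proof.
rewrite /mean2 [RHS]exchange_big/=; apply: eq_bigr => y _.
by rewrite [RHS]exchange_big/=; apply: eq_bigr => z _; rewrite mulr_sumr.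
Qed.

Lemma mean2_fst G : mean2 (fun y _ => G y) = mean G.
Proof.
apply: eq_bigr => y _; rewrite -mulr_suml -mulr_sumr wt_sum1.
by rewrite mulr1.
Qed.

Lemma mean2_prod G1 G2 : mean2 (fun y z => G1 y * G2 z) = mean G1 * mean G2.
Proof.
rewrite /mean big_distrlr; apply: eq_bigr => y _; apply: eq_bigr => z _ /=.
by ring.
Qed.

Lemma wt_mix D y z : wt (mix D y z) * wt (mix D z y) = wt y * wt z.
Proof.
rewrite /wt -!big_split; apply: eq_bigr => r _ /=; rewrite !ffunE.
by case: (D r); rewrite // mulrC.
Qed.

(** Swapping is an involution on pairs that preserves the product weight, so it is a change of
    variables. *)
Lemma mean2_mix D H : mean2 (fun y z => H (mix D y z) (mix D z y)) = mean2 H.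
Proof.
rewrite /mean2 !pair_big /=.
pose g (q : pt * pt) := (mix D q.1 q.2, mix D q.2 q.1).
have gK : involutive g.
  case=> y z; rewrite /g /=; congr pair; apply/ffunP => r; rewrite !ffunE;
  by case: (D r).
rewrite [RHS](reindex_inj (inv_inj gK))/=.
by apply: eq_bigr => -[y z] _; rewrite /= wt_mix.
Qed.

(** Variance through an independent copy [z] of [y], the form suited to telescoping. *)
Lemma var_mean2 G : mean (fun y => (G y - mean G) ^+ 2) =
  mean2 (fun y z => G y * (G y - G z)).
Proof.
have -> : mean2 (fun y z => G y * (G y - G z)) =
    mean (fun y => G y ^+ 2) - mean G ^+ 2.
  rewrite -mean2_fst expr2 -mean2_prod -mulN1r -mean2Z -mean2D.
  by apply: eq_mean2 => y z; ring.
have -> : (fun y => (G y - mean G) ^+ 2) =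
    (fun y => G y ^+ 2 + ((- (mean G *+ 2)) * G y + mean G ^+ 2)).
  by apply: funext => y; ring.
by rewrite !meanD meanZ mean_cst; ring.
Qed.

Definition below (k : nat) : pred 'I_K := fun r => (r < k)%N.

(* Telescoping over the interpolation that resamples the coordinates one by one; the
   swap of the [r]-th coordinates is measure preserving and symmetrises each term. *)
Lemma efron_stein G : mean (fun y => (G y - mean G) ^+ 2) <=
  2^-1 * \sum_r mean2 (fun y z => (G y - G (mix (pred1 r) y z)) ^+ 2).
Proof.
(* Swaps compose by symmetric difference of index sets, so the swap at [r] exchanges [below r] and
   [below r.+1]. *)
have mixmix r D y z : mix (pred1 r) (mix D y z) (mix D z y) =
    mix (fun i => D i (+) (i == r)) y z.
  by apply/ffunP => i; rewrite !ffunE /=; case: (D i); case: (i == r).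
have step (r : 'I_K) y z : mix (fun i => below r i (+) (i == r)) y z = mix (below r.+1) y z.
  apply/ffunP => i; rewrite !ffunE /below ltnS -val_eqE/=.
  by case: ltngtP.
have step' (r : 'I_K) y z : mix (fun i => below r.+1 i (+) (i == r)) y z = mix (below r) y z.
  apply/ffunP => i; rewrite !ffunE /below ltnS -val_eqE/=.
  by case: ltngtP.
have mixswap r D y z : mix D (mix (pred1 r) y z) (mix (pred1 r) z y) =
    mix (fun i => D i (+) (i == r)) y z.
  by apply/ffunP => i; rewrite !ffunE /=; case: (D i); case: (i == r).
rewrite var_mean2 mulr_sumr.
have -> : mean2 (fun y z => G y * (G y - G z)) =
   \sum_(r < K) mean2 (fun y z => G y * (G (mix (below r) y z) - G (mix (below r.+1) y z))).
  rewrite -mean2_sum; apply: eq_mean2 => y z; rewrite -mulr_sumr; congr (_ * _).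
  rewrite -(big_mkord xpredT (fun r => G (mix (below r) y z) - G (mix (below r.+1) y z))).
  rewrite -[RHS]opprK -sumrN; under eq_bigr do rewrite opprB.
  rewrite telescope_sumr// opprB; congr (G _ - G _); apply/ffunP => i.
    by rewrite ffunE.
  by rewrite ffunE /below ltn_ord.
apply: ler_sum => r _.
set H := fun y z => (G y - G (mix (pred1 r) y z)).
set L := fun y z => (G (mix (below r) y z) - G (mix (below r.+1) y z)).
(* Swapping the [r]-th coordinates negates [L] and turns [G y] into its resampled value; averaging
   the two expressions gives the factor [1 / 2]. *)
have E1 : mean2 (fun y z => G y * L y z) = 2^-1 * mean2 (fun y z => H y z * L y z).
  have E : mean2 (fun y z => G y * L y z) =
           mean2 (fun y z => - (G (mix (pred1 r) y z) * L y z)).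
    rewrite -(mean2_mix (pred1 r)); apply: eq_mean2 => y z; rewrite /L !mixswap step step'.
    by ring.
  have -> : mean2 (fun y z => H y z * L y z) =
     mean2 (fun y z => G y * L y z) + mean2 (fun y z => - (G (mix (pred1 r) y z) * L y z)).
    by rewrite -mean2D; apply: eq_mean2 => y z; rewrite /H; ring.
  by rewrite -E; field.
(* [L] is [H] evaluated after swapping the coordinates below [r]. *)
have E2 : mean2 (fun y z => L y z ^+ 2) = mean2 (fun y z => H y z ^+ 2).
  rewrite -[RHS](mean2_mix (below r)); apply: eq_mean2 => y z.
  by rewrite /H /L mixmix step.
rewrite E1 ler_wpM2l//.
have : mean2 (fun y z => H y z * L y z) <=
    mean2 (fun y z => 2^-1 * H y z ^+ 2 + 2^-1 * L y z ^+ 2).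
  apply: mean2_le => y z.
  have := sqr_ge0 (H y z - L y z); nra.
by rewrite mean2D !mean2Z E2; lra.
Qed.

(** The swap at [r] exchanges positive and negative parts of the increment, so they have equal
    second moments, which absorbs the factor [1 / 2]. A subgradient at [y] bounds the positive part
    only. *)
Lemma efron_stein_pos G : mean (fun y => (G y - mean G) ^+ 2) <=
  \sum_r mean2 (fun y z => Num.max 0 (G y - G (mix (pred1 r) y z)) ^+ 2).
Proof.
apply: le_trans (efron_stein G) _.
rewrite mulr_sumr; apply: ler_sum => r _.
set H := fun y z => Num.max 0 (G y - G (mix (pred1 r) y z)) ^+ 2.
have <- : mean2 H + mean2 H = mean2 (fun y z => (G y - G (mix (pred1 r) y z)) ^+ 2).
  rewrite -{2}(mean2_mix (pred1 r)) -mean2D; apply: eq_mean2 => y z; rewrite /H.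
  have -> : mix (pred1 r) (mix (pred1 r) y z) (mix (pred1 r) z y) = y.
    by apply/ffunP => i; rewrite !ffunE /=; case: (i == r).
  set u := G y; set v := G _.
  have [uv|/ltW uv] := leP u v.
    rewrite max_l ?subr_le0// max_r ?subr_ge0//; ring.
  rewrite max_r ?subr_ge0// max_l ?subr_le0//; ring.
by lra.
Qed.

(** Every resampled point is compared with the same [y], so one subgradient serves all blocks and
    its squared norms over the blocks sum to at most [L2]. This is the gain from convexity. *)
Lemma subgradients_var (J : finType) (L2 b : R) (D : nat) (F : (J -> R) -> R)
    (blk : J -> 'I_K) (c : J -> V -> R) (G : pt -> R) :
  (forall y, G y = F (fun j => c j (y (blk j)))) ->
  has_subgradients L2 F ->
  (forall j v, `|c j v| <= b) ->
  (forall r, #|[pred j | blk j == r]| <= D)%N ->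
  mean (fun y => (G y - mean G) ^+ 2) <= 4 * b ^+ 2 * D%:R * L2.
Proof.
move=> GE hF hc hD; pose M (y : pt) j := c j (y (blk j)).
apply: le_trans (efron_stein_pos G) _.
rewrite -mean2_sum -[leRHS]mean2_cst; apply: mean2_le => y z.
have [s [sL sG]] := hF (M y).
apply: (@le_trans _ _ (\sum_(r < K) (4 * b ^+ 2 * D%:R) * \sum_(j | blk j == r) s j ^+ 2)).
  apply: ler_sum => r _.
  set d := \sum_(j | blk j == r) s j * (c j (y r) - c j (z r)).
  have Gd : G y - G (mix (pred1 r) y z) <= d.
    rewrite !GE; apply: le_trans (sG _) _; rewrite [leRHS]big_mkcond/=; apply: ler_sum => j _.
    by rewrite /M ffunE /=; case: eqP => [->|_]//; rewrite subrr mulr0.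
  apply: (@le_trans _ _ (d ^+ 2)).
    have [d0|d0] := leP (G y - G (mix (pred1 r) y z)) 0.
      by rewrite expr0n sqr_ge0.
    by rewrite ler_pXn2r// nnegrE ltW// (lt_le_trans d0).
  rewrite (le_trans (sum_cauchy_schwarz _ _ _))// mulrC ler_wpM2r//.
    by apply: sumr_ge0 => j _; rewrite sqr_ge0.
  (* Each coordinate moves by at most [2 * b], and the block has at most [D] of them. *)
  apply: (@le_trans _ _ (\sum_(j | blk j == r) 4 * b ^+ 2)).
    apply: ler_sum => j _; have := hc j (y r); have := hc j (z r).
    rewrite !ler_norml => /andP[z1 z2] /andP[y1 y2].
    have h1 : `|c j (y r) - c j (z r)| <= 2 * b by rewrite ler_norml; apply/andP; lra.
    rewrite -real_normK ?num_real//.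
    rewrite (_ : 4 * b ^+ 2 = (2 * b) ^+ 2); last by ring.
    by rewrite ler_pXn2r// nnegrE ?(le_trans _ h1).
  rewrite sumr_const -[leLHS]mulr_natr ler_wpM2l//.
    by rewrite mulr_ge0// sqr_ge0.
  by rewrite ler_nat; apply: hD.
rewrite -mulr_sumr ler_wpM2l//.
  by rewrite mulr_ge0// mulr_ge0// sqr_ge0.
apply: le_trans sL; rewrite le_eqVlt; apply/orP; left; apply/eqP.
by rewrite [RHS](partition_big blk xpredT).
Qed.

End EfronStein.

(** * Approximation by combinations of absolute values *)

Section AbsApproximation.
Variable R : realType.
Implicit Types (c : R) (l : seq (R * R)).

Definition abs_comb c l (x : R) : R := c + \sum_(q <- l) q.1 * `|x - q.2|.

Definition total_weight l : R := \sum_(q <- l) `|q.1|.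

Lemma total_weight_ge0 l : 0 <= total_weight l.
Proof. exact: sumr_ge0. Qed.

(* The function [x |-> D * (1 + (|x - t| - |x - t - d|) / d) / 2] is a ramp: it vanishes
   left of [t] and equals [D] right of [t + d]. *)
Lemma lipschitz_abs_comb_approx (f : R -> R) (b e : R) :
  (forall x y, `|f x - f y| <= `|x - y|) -> (forall x, b <= `|x| -> f x = 0) ->
  0 <= b -> 0 < e -> exists c l, forall x, `|f x - abs_comb c l x| <= e.
Proof.
move=> fL fb b0 e0; pose d := e / 2; have d0 : 0 < d by rewrite divr_gt0.
pose t (k : nat) := - b + k%:R * d.
have tS k : t k.+1 = t k + d by rewrite /t -natr1; ring.
have fl x : x <= - b -> f x = 0.
  by move=> xb; apply: fb; rewrite ler0_norm; lra.
(* Induction over the nodes: right of the last node the combination is constant, equal to [f] there;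
   left of it the error is at most [e]. The chosen last node lies beyond [b], where [f] vanishes. *)
suff [c [l [cl1 cl2]]] : exists c l, (forall x, t (Num.truncn (2 * b / d)).+1 <= x ->
      abs_comb c l x = f (t (Num.truncn (2 * b / d)).+1)) /\
      (forall x, x <= t (Num.truncn (2 * b / d)).+1 -> `|f x - abs_comb c l x| <= e).
  exists c, l => x; have [|/ltW xt] := leP x (t (Num.truncn (2 * b / d)).+1).
    exact: cl2.
  have bt : b <= t (Num.truncn (2 * b / d)).+1.
    have := truncnS_gt (2 * b / d); rewrite ltr_pdivrMr// => h.
    by rewrite /t; lra.
  rewrite cl1// !fb ?subrr ?normr0 ?(ltW e0)// ger0_norm//; lra.
elim: (Num.truncn _).+1 => [|k [c [l [IH1 IH2]]]].
  have t0 : t 0%N = - b by rewrite /t mul0r addr0.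
  exists 0, [::]; rewrite t0; split=> x xb; rewrite /abs_comb big_nil addr0.
    by rewrite fl.
  by rewrite fl// subrr normr0 ltW.
pose D := f (t k.+1) - f (t k).
have Dd : `|D| <= d by rewrite (le_trans (fL _ _))// tS addrAC subrr add0r ger0_norm// ltW.
pose l' := (D / (2 * d), t k) :: (- (D / (2 * d)), t k.+1) :: l.
have pE x : abs_comb (c + D / 2) l' x = abs_comb c l x +
    D * (1 + (`|x - t k| - `|x - t k.+1|) / d) / 2.
  rewrite /abs_comb !big_cons/=; field; exact: lt0r_neq0.
exists (c + D / 2), l'; split=> x xt.
  have xt' : t k <= x by rewrite (le_trans _ xt)// tS; lra.
  rewrite pE IH1// ger0_norm ?subr_ge0// ger0_norm ?subr_ge0// tS.
  rewrite (_ : x - t k - (x - (t k + d)) = d); last by ring.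
  rewrite divff ?lt0r_neq0// /D tS; lra.
have [xk|/ltW xk] := leP x (t k).
  rewrite pE [`|x - t k|]ler0_norm ?subr_le0// [`|x - t k.+1|]ler0_norm ?subr_le0// tS.
  rewrite (_ : - (x - t k) - - (x - (t k + d)) = - d); last by ring.
  rewrite mulNr divff ?lt0r_neq0// subrr mulr0 mul0r addr0; exact: IH2.
rewrite pE IH1// [`|x - t k|]ger0_norm ?subr_ge0// [`|x - t k.+1|]ler0_norm ?subr_le0//.
have -> : D * (1 + (x - t k - - (x - t k.+1)) / d) / 2 = D * ((x - t k) / d).
  by rewrite tS; field; exact: lt0r_neq0.
have r1 : 0 <= (x - t k) / d by rewrite divr_ge0 ?subr_ge0// ltW.
have r2 : (x - t k) / d <= 1 by rewrite ler_pdivrMr// mul1r; move: xt; rewrite tS; lra.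
rewrite opprD addrA (le_trans (ler_normB _ _))// normrM (ger0_norm r1).
(* Between two nodes [f] and the combination each stay within [d], half of [e], of [f (t k)]. *)
have h1 : `|f x - f (t k)| <= d.
  by rewrite (le_trans (fL _ _))// ger0_norm ?subr_ge0//; move: xt; rewrite tS; lra.
have h2 : `|D| * ((x - t k) / d) <= d by rewrite -[leRHS]mulr1 ler_pM.
by move: h1 h2; rewrite /d; lra.
Qed.

(** Cauchy-Schwarz for the weights [|a q|], by induction on the list; the cross term is handled by
    the arithmetic-geometric mean inequality. *)
Lemma weighted_sum_sqr (I : Type) (u : seq I) (a z : I -> R) :
  (\sum_(q <- u) a q * z q) ^+ 2 <=
  (\sum_(q <- u) `|a q|) * \sum_(q <- u) `|a q| * z q ^+ 2.
Proof.
elim: u => [|q u IH]; first by rewrite !big_nil expr0n mul0r.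
rewrite !big_cons; move: IH.
set S := \sum_(j <- u) a j * z j; set M : R := \sum_(j <- u) `|a j|.
set V : R := \sum_(j <- u) `|a j| * z j ^+ 2 => IH.
have M0 : 0 <= M by apply: sumr_ge0.
have V0 : 0 <= V by apply: sumr_ge0 => j _; rewrite mulr_ge0// sqr_ge0.
have h : `|2 * S * z q| <= V + M * z q ^+ 2.
  rewrite -ler_sqr ?nnegrE//; last by rewrite addr_ge0// mulr_ge0// sqr_ge0.
  rewrite real_normK ?num_real//.
  apply: (@le_trans _ _ (4 * (M * V) * z q ^+ 2)).
    rewrite (_ : (2 * S * z q) ^+ 2 = 4 * S ^+ 2 * z q ^+ 2); last by ring.
    by rewrite ler_wpM2r ?sqr_ge0// ler_wpM2l.
  by have := sqr_ge0 (V - M * z q ^+ 2); lra.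
have h2 : 2 * S * z q * a q <= `|a q| * (V + M * z q ^+ 2).
  by rewrite (le_trans (ler_norm _))// normrM mulrC ler_wpM2l.
have h3 : a q ^+ 2 = `|a q| ^+ 2 by rewrite real_normK ?num_real.
have -> : (a q * z q + S) ^+ 2 = a q ^+ 2 * z q ^+ 2 + 2 * S * z q * a q + S ^+ 2 by ring.
rewrite h3; set A := `|a q| in h2 *.
have -> : (A + M) * (A * z q ^+ 2 + V) = A ^+ 2 * z q ^+ 2 + A * (V + M * z q ^+ 2) + M * V by ring.
by lra.
Qed.

(** * Spectral statistics of combinations of absolute values *)

Section Esd.
Variables (n : nat) (n_gt0 : (0 < n)%N).

Lemma esd_int_spec (f : R -> R) (A : 'M[R[i]]_n) : herm_mx A ->
  esd_int f A = n%:R^-1 * \sum_i f (spec_re A i).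
Proof. by move=> hA; rewrite /esd_int sum_eigs. Qed.

Lemma esd_int_norm_le (f : R -> R) (B : R) (A : 'M[R[i]]_n) : herm_mx A ->
  (forall x, `|f x| <= B) -> `|esd_int f A| <= B.
Proof.
move=> hA fB; rewrite esd_int_spec// normrM ger0_norm ?invr_ge0//.
rewrite mulrC ler_pdivrMr ?ltr0n// (le_trans (ler_norm_sum _ _ _))//.
rewrite (le_trans (ler_sum _ (fun i _ => fB _)))//.
by rewrite sumr_const card_ord mulr_natr.
Qed.

Lemma esd_int_close (f g : R -> R) (e : R) (A : 'M[R[i]]_n) : herm_mx A ->
  (forall x, `|f x - g x| <= e) -> `|esd_int f A - esd_int g A| <= e.
Proof.
move=> hA fg; have := @esd_int_norm_le (fun x => f x - g x) e A hA fg.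
by rewrite !esd_int_spec// sumrB mulrBr.
Qed.

Definition abs_esd_comb c l (x : entry n -> R) : R :=
  c + \sum_(q <- l) q.1 * abs_esd q.2 x.

Lemma esd_int_abs_comb c l (x : entry n -> R) :
  esd_int (abs_comb c l) (herm_of x) = abs_esd_comb c l x.
Proof.
have hA := herm_of_herm x; rewrite esd_int_spec// /abs_comb big_split/=.
rewrite sumr_const card_ord mulrDr -[c *+ n]mulr_natr mulrCA mulVf ?pnatr_eq0 -?lt0n//.
rewrite mulr1 /abs_esd_comb exchange_big mulr_sumr; congr (_ + _).
apply: eq_bigr => q _; rewrite /abs_esd esd_int_spec// mulrCA; congr (_ * _).
by rewrite mulr_sumr.
Qed.

Lemma abs_esd_comb_lipschitz c l (x y : entry n -> R) :
  (abs_esd_comb c l x - abs_esd_comb c l y) ^+ 2 <=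
  total_weight l ^+ 2 * (n%:R ^- 2 * \sum_j (x j - y j) ^+ 2).
Proof.
rewrite /abs_esd_comb opprD addrACA subrr add0r -sumrB.
under eq_bigr do rewrite -mulrBr.
rewrite (le_trans (weighted_sum_sqr _ _ _))// expr2 -mulrA ler_wpM2l ?total_weight_ge0//.
rewrite mulr_suml; apply: ler_sum => q _; rewrite ler_wpM2l//.
exact: subgradients_lipschitz (abs_esd_subgradients _ n_gt0).
Qed.

End Esd.
End AbsApproximation.

(** The coefficients may be negative, so the combination need not be convex. Weighted Cauchy-Schwarz
    bounds its variance by those of the single terms, which are convex. *)
Lemma abs_esd_comb_var (R : realType) (V : finType) (K n : nat) (p : 'I_K -> V -> R)
    (c b : R) (l : seq (R * R)) (D : nat) (blk : entry n -> 'I_K) (v : entry n -> V -> R)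
    (G : {ffun 'I_K -> V} -> R) :
  (0 < n)%N -> (forall r v, 0 <= p r v) -> (forall r, \sum_v p r v = 1) ->
  (forall y, G y = abs_esd_comb c l (fun j => v j (y (blk j)))) ->
  (forall j u, `|v j u| <= b) ->
  (forall r, #|[pred j | blk j == r]| <= D)%N ->
  mean p (fun y => (G y - mean p G) ^+ 2) <=
  total_weight l ^+ 2 * (4 * b ^+ 2 * D%:R * n%:R ^- 2).
Proof.
move=> n0 p0 p1 GE vb hD.
pose H (q : R * R) (y : {ffun 'I_K -> V}) := abs_esd q.2 (fun j => v j (y (blk j))).
have mG : mean p G = c + \sum_(q <- l) q.1 * mean p (H q).
  rewrite /mean; under eq_bigr do rewrite GE /abs_esd_comb mulrDr mulr_sumr.
  rewrite big_split/= -mulr_suml (wt_sum1 p1) mul1r exchange_big/=; congr (_ + _).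
  apply: eq_bigr => q _; rewrite mulr_sumr; apply: eq_bigr => y _.
  by rewrite mulrCA.
apply: (@le_trans _ _ (mean p (fun y => total_weight l *
    \sum_(q <- l) `|q.1| * (H q y - mean p (H q)) ^+ 2))).
  apply: mean_le => // y; rewrite mG GE /abs_esd_comb opprD addrACA subrr add0r -sumrB.
  under eq_bigr do rewrite -mulrBr.
  exact: weighted_sum_sqr.
rewrite meanZ expr2 -mulrA ler_wpM2l ?total_weight_ge0//.
have -> : mean p (fun y => \sum_(q <- l) `|q.1| * (H q y - mean p (H q)) ^+ 2) =
    \sum_(q <- l) `|q.1| * mean p (fun y => (H q y - mean p (H q)) ^+ 2).
  rewrite /mean; under eq_bigr do rewrite mulr_sumr.
  rewrite exchange_big/=; apply: eq_bigr => q _; rewrite mulr_sumr; apply: eq_bigr => y _.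
  by rewrite mulrCA.
rewrite mulr_suml; apply: ler_sum => q _; rewrite ler_wpM2l//.
exact: (subgradients_var p0 p1 (fun=> erefl) (abs_esd_subgradients q.2 n0) vb hD).
Qed.

(** * Discretisation of the random matrix *)

Section FiniteValued.
Context d (T : measurableType d) (R : realType) (P : probability T R).
Variables (U : finType) (Y : T -> U).
Hypothesis mY : forall u, measurable (Y @^-1` [set u]).

Lemma measurable_finite_preimage (Q : set U) : measurable (Y @^-1` Q).
Proof.
have -> : Y @^-1` Q = \bigcup_(u in Q) (Y @^-1` [set u]).
  by apply/seteqP; split=> [w /= Qw|w /= [u Qu ->]//]; exists (Y w).
by apply: fin_bigcup_measurable => //; exact: finite_finset.
Qed.

Lemma measurable_finite_comp (h : U -> R) : measurable_fun setT (h \o Y).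
Proof.
move=> _ B mB; rewrite setTI.
exact: (measurable_finite_preimage [set u | B (h u)]).
Qed.

Lemma probability_finite_preimage (Q : pred U) :
  P [set w | Q (Y w)] = (\sum_(u | Q u) P (Y @^-1` [set u]))%E.
Proof.
have H (s : seq U) : uniq s ->
    P [set w | Y w \in s] = (\sum_(u <- s) P (Y @^-1` [set u]))%E.
  elim: s => [_|u s IH /= /andP[us su]].
    by rewrite big_nil (_ : [set w | _] = set0) ?measure0// -subset0 => w.
  rewrite big_cons -IH// -measureU//.
  - congr (P _); apply/seteqP; split=> w /=; rewrite inE.
      by move=> /orP[/eqP|]; [left|right].
    by move=> [->|->]; rewrite ?eqxx ?orbT.
  - exact: (measurable_finite_preimage [set u | u \in s]).
  - by rewrite -subset0 => w /= [->]; rewrite (negbTE us).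
rewrite -big_enum -H ?enum_uniq//; congr (P _).
by apply: eq_set => w; rewrite mem_enum.
Qed.

End FiniteValued.

(** Cells of width [e] starting at [- b] decode to their left endpoints; code 0 is reserved for
    values outside [[- b, b]] and decodes to 0, so rounding also truncates. *)
Lemma finite_rounding (R : realType) (b e : R) : 0 <= b -> 0 < e ->
  exists (V : finType) (code : R -> V) (val : V -> R),
    [/\ forall v, measurable (code @^-1` [set v]), forall v, `|val v| <= b,
        forall x, `|x| <= b -> `|x - val (code x)| <= e &
        forall x, b < `|x| -> val (code x) = 0].
Proof.
move=> b0 e0; pose N := Num.truncn (2 * b / e).
(* Cell indices run from 0 to [N] and are shifted by one to free code 0, hence [N.+2] codes. *)
pose code x : 'I_N.+2 := if `|x| <= b then inord (Num.truncn ((x + b) / e)).+1 else ord0.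
pose val (v : 'I_N.+2) := if v == 0%N :> nat then 0 else v.-1%:R * e - b.
have codeE x : `|x| <= b -> code x = (Num.truncn ((x + b) / e)).+1 :> nat.
  move=> xb; rewrite /code xb inordK// !ltnS /N; apply: le_truncn.
  rewrite ler_pM2r ?invr_gt0//; have := ler_norm x; lra.
have trunc_itv x : `|x| <= b -> let k := Num.truncn ((x + b) / e) in
    k%:R * e <= x + b < k.+1%:R * e.
  move=> xb; rewrite /= -ler_pdivlMr// -ltr_pdivrMr//; apply: truncn_itv.
  by rewrite divr_ge0 ?(ltW e0)//; move: xb; rewrite ler_norml => /andP[]; lra.
exists 'I_N.+2, code, val; split.
- move=> v; have mle : measurable [set x : R | `|x| <= b].
    rewrite (_ : [set x | _] = `[- b, b]%classic); first exact: measurable_itv.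
    by apply/seteqP; split=> x /=; rewrite in_itv/= ler_norml.
  have [v0|v0] := eqVneq (v : nat) 0%N.
    rewrite (_ : _ @^-1` _ = ~` [set x : R | `|x| <= b]); first exact: measurableC.
    apply/seteqP; split=> x /=; last by rewrite /code => /negP/negbTE ->; apply/val_inj.
    by move=> xv xb; move: (codeE x xb); rewrite xv v0.
  rewrite (_ : _ @^-1` _ = [set x : R | `|x| <= b] `&`
      `[v.-1%:R * e - b, v%:R * e - b[%classic).
    by apply: measurableI => //; exact: measurable_itv.
  apply/seteqP; split=> x /=.
    have [xb xv|xb] := leP `|x| b; last first.
      by rewrite /code leNgt xb /= => vE; move: v0; rewrite -vE.
    split=> //; rewrite in_itv/= -xv codeE//=.
    by have /andP[] := trunc_itv x xb => h1 h2; apply/andP; split; lra.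
  move=> [xb]; rewrite in_itv/= => xv; apply/val_inj => /=; rewrite codeE//.
  rewrite -[RHS]prednK ?lt0n//; congr _.+1; apply: truncn_def.
  rewrite ler_pdivlMr// ltr_pdivrMr// prednK ?lt0n//.
  by move: xv => /andP[h1 h2]; apply/andP; split; lra.
- move=> v; rewrite /val; case: eqP => [_|/eqP v0]; first by rewrite normr0.
  have vN : (v.-1%:R : R) <= N%:R.
    by rewrite ler_nat -ltnS prednK ?lt0n// -ltnS.
  have Ne : N%:R * e <= 2 * b.
    rewrite -ler_pdivlMr// truncn_le divr_ge0 ?mulr_ge0 ?(ltW e0)//.
  have : v.-1%:R * e <= 2 * b by rewrite (le_trans _ Ne)// ler_wpM2r// ltW.
  have : 0 <= v.-1%:R * e by rewrite mulr_ge0// ltW.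
  by move=> h1 h2; rewrite ler_norml; apply/andP; split; lra.
- move=> x xb; rewrite /val codeE//= ger0_norm.
    by have /andP[_] := trunc_itv x xb; rewrite -natr1; lra.
  by have /andP[+ _] := trunc_itv x xb; lra.
- by move=> x xb; rewrite /code leNgt xb.
Qed.

Section Discretisation.
Context d (T : measurableType d) (R : realType) (P : probability T R).
Variables (n : nat) (X : T -> 'M[R[i]]_n) (K : nat) (part : 'I_n -> 'I_n -> 'I_K).
Variables (V : finType) (code : R -> V).
Hypothesis mX : forall i j, measurable_fun setT (fun w => complex.Re (X w i j)) /\
                            measurable_fun setT (fun w => complex.Im (X w i j)).
Hypothesis mcode : forall v, measurable (code @^-1` [set v]).

Definition block (k : entry n) : 'I_K := part k.1.1 k.1.2.

(* Entries outside the block [r] are replaced by a default, so that the [r]-th component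
   depends on the block [r] only. *)
Definition codes (w : T) : {ffun 'I_K -> {ffun entry n -> V}} :=
  [ffun r => [ffun k => if block k == r then code (coords (X w) k) else code 0]].

(** Places the events of the discretised blocks in the sigma-algebras to which the independence
    hypothesis applies. *)
Lemma block_sigma_codes r v :
  block_sigma X [set ij | part ij.1 ij.2 = r] [set w | codes w r = v].
Proof.
pose G := [set E | exists (i j : 'I_n), [set ij | part ij.1 ij.2 = r] (i, j) /\
  exists A : set R, measurable A /\ (E = (fun w => complex.Re (X w i j)) @^-1` A \/
                                     E = (fun w => complex.Im (X w i j)) @^-1` A)].
rewrite -[block_sigma _ _]/(@measurable _ (g_sigma_algebraType G)).
have -> : [set w | codes w r = v] = \bigcap_(k in [set: entry n]) [set w | codes w r k = v k].
  apply/seteqP; split=> w /=; first by move=> h k _ /=; rewrite h.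
  by move=> h; apply/ffunP => k; apply: h k I.
apply: fin_bigcap_measurable => [|k _]; first exact: finite_finset.
have [kr|kr] := eqVneq (block k) r; last first.
  rewrite (_ : [set w | _] = [set w | code 0 = v k]); last first.
    by apply: eq_set => w; rewrite /codes !ffunE (negbTE kr).
  have [vk|vk] := pselect (code 0 = v k).
    by rewrite (_ : [set w | _] = setT) //; apply/seteqP; split.
  by rewrite (_ : [set w | _] = set0) //; apply/seteqP; split.
rewrite (_ : [set w | _] = (fun w => coords (X w) k) @^-1` (code @^-1` [set v k])); last first.
  by apply: eq_set => w /=; rewrite /codes !ffunE kr eqxx.
apply: sub_sigma_algebra; move: k kr => [[i j] []] /= kr; exists i, j; split=> //=.
- by exists (code @^-1` [set v (i, j, true)]); split=> //; right.
- by exists (code @^-1` [set v (i, j, false)]); split=> //; left.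
Qed.

Arguments block_sigma_codes : clear implicits.

Lemma block_sigma_measurable B E : block_sigma X B E -> measurable E.
Proof.
apply: smallest_sub; first exact: sigma_algebra_measurable.
move=> _ [i [j [_ [A [mA [->|->]]]]]]; rewrite -[X in measurable X]setTI.
- exact: (mX i j).1.
- exact: (mX i j).2.
Qed.

Lemma codesE y : codes @^-1` [set y] =
  \bigcap_(r in [set: 'I_K]) [set w | codes w r = y r].
Proof.
apply/seteqP; split=> w /=; first by move=> h k _ /=; rewrite h.
by move=> h; apply/ffunP => k; apply: h k I.
Qed.

Lemma measurable_codes y : measurable (codes @^-1` [set y]).
Proof.
rewrite codesE; apply: fin_bigcap_measurable => [|r _]; first exact: finite_finset.
exact: block_sigma_measurable (block_sigma_codes r (y r)).
Qed.

Definition block_law (r : 'I_K) (v : {ffun entry n -> V}) : R :=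
  fine (P [set w | codes w r = v]).

Lemma block_law_ge0 r v : 0 <= block_law r v.
Proof. exact: fine_ge0. Qed.

Lemma block_lawE r v : P [set w | codes w r = v] = (block_law r v)%:E.
Proof.
rewrite /block_law fineK// fin_num_measure//.
exact: block_sigma_measurable (block_sigma_codes r v).
Qed.

Lemma block_law_sum1 r : \sum_v block_law r v = 1.
Proof.
apply: EFin_inj; rewrite -sumEFin -(@probability_setT _ _ _ P).
under eq_bigr do rewrite -block_lawE.
rewrite -(@probability_finite_preimage _ _ _ P _ (fun w => codes w r) _ xpredT).
  by congr (P _); apply/seteqP; split.
by move=> v; exact: block_sigma_measurable (block_sigma_codes r v).
Qed.

Hypothesis indep : forall A : 'I_K -> set T,
  (forall r, block_sigma X [set ij | part ij.1 ij.2 = r] (A r)) ->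
  P (\bigcap_(r in [set: 'I_K]) A r) = (\prod_(r < K) P (A r))%E.

(** Independence of the blocks makes the law of [codes] a product weight, so probabilities become
    finite sums to which Efron-Stein applies. *)
Lemma codes_law y : P (codes @^-1` [set y]) = (wt block_law y)%:E.
Proof.
rewrite codesE (indep (fun r => block_sigma_codes r (y r))) /wt.
rewrite (eq_bigr (fun r => (block_law r (y r))%:E)); last first.
  by move=> r _; rewrite -block_lawE.
by rewrite prodEFin.
Qed.

Lemma codes_chebyshev (G : {ffun 'I_K -> {ffun entry n -> V}} -> R) (m e : R) : 0 < e ->
  (P [set w | (e < `|G (codes w) - m|)%R] <=
   (e ^- 2 * mean block_law (fun y => (G y - m) ^+ 2))%:E)%E.
Proof.
move=> e0; rewrite (probability_finite_preimage _ measurable_codes (fun y => e < `|G y - m|)).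
under eq_bigr do rewrite codes_law.
rewrite sumEFin lee_fin /mean mulr_sumr [leLHS]big_mkcond/=; apply: ler_sum => y _.
have w0 := wt_ge0 block_law_ge0 y.
case: ifP => [eG|_].
  rewrite mulrCA ler_peMr// mulrC ler_pdivlMr ?exprn_gt0// mul1r.
  by rewrite -[leRHS]real_normK ?num_real// ler_pXn2r ?nnegrE ?(ltW e0)// ltW.
by rewrite mulr_ge0 ?invr_ge0 ?sqr_ge0// mulr_ge0// sqr_ge0.
Qed.

End Discretisation.

(** * Truncation and concentration *)

Lemma compact_support_bounded (R : realType) (f : R -> R) :
  compact (closure (f @^-1` [set~ 0])) ->
  exists2 b : R, 0 <= b & forall x, b <= `|x| -> f x = 0.
Proof.
(* Any number above [M] bounds the support; [|M| + 1] is one, and the further 1 gives a strict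
   contradiction. *)
move=> /compact_bounded [M [_ HM]]; exists (`|M| + 2) => [|x xM]; first by rewrite addr_ge0.
apply: contrapT => fx.
have : `|x| <= `|M| + 1.
  apply: HM; last exact: subset_closure.
  by rewrite (le_lt_trans (ler_norm _))// ltrDl.
by lra.
Qed.

(** The deviation is at most [e] off the exceptional event and at most [D] on it. This lets the
    expectation replace another centre [m]. *)
Lemma expectation_close d (T : measurableType d) (R : realType) (P : probability T R)
    (Z : T -> R) (m e D k : R) : measurable_fun setT Z ->
  (forall w, `|Z w - m| <= D) -> 0 <= e ->
  (P [set w | (e < `|Z w - m|)%R] <= k%:E)%E ->
  `|fine 'E_P[Z] - m| <= e + D * k.
Proof.
move=> mZ ZD e0 Pk; set A := [set w | _] in Pk.
have mA : measurable A.
  rewrite -[X in measurable X]setTI.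
  apply: (measurable_fun_ltr (measurable_cst _) _ measurableT (Y := [set true])) => //.
  by apply: measurableT_comp => //; exact: measurable_funB.
have bint (g : T -> R) (M : R) : measurable_fun setT g -> (forall w, `|g w| <= M) ->
    P.-integrable setT (EFin \o g).
  move=> mg gM; apply: measurable_bounded_integrable => //.
    by rewrite [ltLHS](@probability_setT _ _ _ P) ltry.
  exists M; split; first exact: num_real.
  by move=> x Mx w _ /=; rewrite (le_trans (gM w))// ltW.
have D0 : 0 <= D by rewrite (le_trans _ (ZD point)).
have iZ : P.-integrable setT (EFin \o Z).
  apply: (bint _ (D + `|m|)) => // w.
  by rewrite -[Z w](subrK m) (le_trans (ler_normD _ _))// lerD2r.
have ic c : P.-integrable setT (EFin \o (fun=> c) : T -> \bar R).
  by apply: (bint (fun=> c) `|c|) => //; exact: measurable_cst.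
have mZm : measurable_fun setT (fun w => Z w - m) by exact: measurable_funB.
have iA : P.-integrable setT (EFin \o (\1_A : T -> R)) by exact: integrable_indic.
have intc (c : R) : \int[P]_(w in [set: T]) c = c.
  by rewrite Rintegral_cst// [X in fine X](@probability_setT _ _ _ P) mulr1.
have -> : fine 'E_P[Z] - m = \int[P]_w (Z w - m).
  by rewrite RintegralB ?intc// unlock.
apply: le_trans (le_normr_Rintegral measurableT _) _; first exact: (bint _ D).
have iDA : P.-integrable setT (EFin \o (fun w => D * \1_A w)).
  apply: (bint _ D) => [|w]; first by apply: measurable_funM => //; exact: measurable_cst.
  rewrite normrM (ger0_norm D0) ler_piMr// indicE; case: (_ \in _) => //=.
    by rewrite normr1.
  by rewrite normr0.
apply: (@le_trans _ _ (\int[P]_w (e + D * \1_A w))).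
  apply: le_Rintegral => //.
  - apply: (bint _ D) => [|w]; first exact: measurableT_comp.
    by rewrite normr_id.
  - by have := integrableD measurableT (ic e) iDA; apply: eq_integrable.
  move=> w _; rewrite indicE; have [ew|ew] := ltP e `|Z w - m|.
    by rewrite mem_set// mulr1 (le_trans (ZD w))// lerDr.
  by rewrite memNset ?mulr0 ?addr0//= /A/=; apply/negP; rewrite -leNgt.
rewrite RintegralD// intc RintegralZl//.
rewrite lerD2l ler_wpM2l// /Rintegral integral_indic// setIT.
by rewrite -lee_fin fineK// fin_num_measure.
Qed.

(** Passing through a combination of absolute values makes the modulus [r] independent of the
    dimension. *)
Lemma esd_int_modulus (R : realType) (f : R -> R) (b e : R) :
  (forall x y, `|f x - f y| <= `|x - y|) -> (forall x, b <= `|x| -> f x = 0) ->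
  0 <= b -> 0 < e ->
  exists2 r : R, 0 < r & forall n (x y : entry n -> R), (0 < n)%N ->
    n%:R ^- 2 * \sum_k (x k - y k) ^+ 2 <= r ->
    `|esd_int f (herm_of x) - esd_int f (herm_of y)| <= e.
Proof.
move=> fL fb b0 e0.
have e40 : 0 < e / 4 by lra.
have tri (u v p q : R) : `|u - p| <= e / 4 -> `|v - q| <= e / 4 -> `|p - q| <= e / 2 ->
    `|u - v| <= e.
  by rewrite !ler_norml => /andP[? ?] /andP[? ?] /andP[? ?]; apply/andP; split; lra.
have [c [l fcl]] := lipschitz_abs_comb_approx fL fb b0 e40.
set W := total_weight l; have W0 : 0 <= W := total_weight_ge0 l.
have W1 : 0 < W + 1 by rewrite ltr_wpDl.
have r0 : 0 < e / 2 / (W + 1) by rewrite !divr_gt0.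
have We : W * (e / 2 / (W + 1)) <= e / 2.
  by rewrite mulrA ler_pdivrMr// mulrC ler_wpM2l ?lerDl// ltW// divr_gt0.
(* Each of two approximations costs [e / 4] and the Lipschitz bound [e / 2]; [W + 1] avoids dividing
   by zero. *)
exists ((e / 2 / (W + 1)) ^+ 2) => [|n x y n0 xy]; first by rewrite exprn_gt0.
apply: (tri _ _ (abs_esd_comb c l x) (abs_esd_comb c l y)).
- by rewrite -esd_int_abs_comb//; apply: esd_int_close => //; exact: herm_of_herm.
- by rewrite -esd_int_abs_comb//; apply: esd_int_close => //; exact: herm_of_herm.
rewrite -ler_sqr ?nnegrE ?divr_ge0 ?(ltW e0)//.
rewrite real_normK ?num_real// (le_trans (abs_esd_comb_lipschitz n0 _ _ _ _))//.
rewrite (le_trans (ler_wpM2l (sqr_ge0 _) xy))// -exprMn.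
by rewrite ler_sqr ?nnegrE ?divr_ge0 ?(ltW e0)// mulr_ge0// ltW.
Qed.

(** * Measurability of the statistic and the rounding error *)

Section EsdMeasurable.
Context d (T : measurableType d) (R : realType).
Variables (X : forall n : nat, T -> 'M[R[i]]_n) (n : nat) (n_gt0 : (0 < n)%N).
Hypothesis hX : forall w, herm_mx (X n w).
Hypothesis mX : forall i j : 'I_n, measurable_fun setT (fun w => complex.Re (X n w i j)) /\
                                   measurable_fun setT (fun w => complex.Im (X n w i j)).

Lemma esd_statE f w : esd_stat f X n w = esd_int f (herm_of (coords (X n w))).
Proof. by rewrite /esd_stat herm_of_coords. Qed.

(** The statistic is the pointwise limit of its values at rounded matrices, which are functions of
    finitely valued measurable codes. *)
Lemma measurable_esd_stat (f : R -> R) (b : R) :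
  (forall x y, `|f x - f y| <= `|x - y|) -> (forall x, b <= `|x| -> f x = 0) ->
  0 <= b -> measurable_fun setT (esd_stat f X n).
Proof.
move=> fL fb b0.
have /choice[g gP] (m : nat) : exists g : T -> R, measurable_fun setT g /\
    forall w, (forall k, `|coords (X n w) k| <= m%:R) -> exists y,
      g w = esd_int f (herm_of y) /\ forall k, `|coords (X n w) k - y k| <= m.+1%:R^-1.
  have [||V [code [val [mc _ valc _]]]] := @finite_rounding R m%:R m.+1%:R^-1 => //.
  (* With a single block, [codes] records the whole matrix. *)
  pose part (i j : 'I_n) : 'I_1 := ord0.
  pose h (y : {ffun 'I_1 -> {ffun entry n -> V}}) : R :=
    esd_int f (herm_of (fun k => val (y ord0 k))).
  exists (h \o codes (X n) part code); split.
    by apply: measurable_finite_comp; exact: measurable_codes.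
  move=> w wm; exists (fun k => val (code (coords (X n w) k))); split.
    rewrite /h/=; congr (esd_int f (herm_of _)); apply: funext => k.
    by rewrite /codes !ffunE /block eqxx.
  by move=> k; apply: valc.
apply: (@measurable_fun_cvg _ _ _ _ g) => [m|w _]; first by have [] := gP m.
apply/cvgrPdist_le => e e0; rewrite esd_statE.
have [r r0 hr] := esd_int_modulus fL fb b0 e0.
pose M := \sum_k `|coords (X n w) k|.
near=> m.
have [y [-> yk]] : exists y, g m w = esd_int f (herm_of y) /\
    forall k, `|coords (X n w) k - y k| <= m.+1%:R^-1.
  apply: (gP m).2 => k; apply: (@le_trans _ _ M).
    by rewrite /M (bigD1 k)//= lerDl sumr_ge0.
  by near: m; exact: nbhs_infty_ger.
apply: hr => //.
(* Each of the [2 * n ^ 2] coordinates then has squared error at most [r / 2]. *)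
have mr : m.+1%:R^-1 <= r / 2.
  rewrite -[leRHS]invrK lef_pV2 ?posrE ?invr_gt0 ?divr_gt0//.
  rewrite (@le_trans _ _ m%:R) ?ler_nat//.
  by near: m; exact: nbhs_infty_ger.
rewrite mulrC ler_pdivrMr ?exprn_gt0 ?ltr0n//.
apply: (@le_trans _ _ (\sum_(k : entry n) r / 2)).
  apply: ler_sum => k _; rewrite -real_normK ?num_real//.
  have h1 := yk k; have m1 : (m.+1%:R^-1 : R) <= 1 by rewrite invf_le1 ?ler1n ?ltr0n.
  have h0 := normr_ge0 (coords (X n w) k - y k).
  by rewrite expr2 (le_trans (ler_pM h0 h0 (le_trans h1 mr) (le_trans h1 m1)))// mulr1.
rewrite sumr_const !card_prod card_ord card_bool -[leLHS]mulr_natr !natrM.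
rewrite le_eqVlt; apply/orP; left; apply/eqP; field.
Unshelve. all: by end_near. Qed.

Lemma measurable_cmod i j : measurable_fun setT (fun w => cmod (X n w i j)).
Proof.
apply: measurableT_comp; first exact: continuous_measurable_fun (@sqrt_continuous R).
by apply: measurable_funD; apply: measurable_funX; have [] := mX i j.
Qed.

Definition truncated_moment (e a : R) (w : T) : R := n%:R ^- 2 *
  \sum_(i < n) \sum_(j < n)
    cmod (X n w i j) ^+ 2 * (if e * a < cmod (X n w i j) then 1 else 0).

Lemma measurable_truncated_moment (e a : R) :
  measurable [set w | e < truncated_moment e a w].
Proof.
rewrite -[X in measurable X]setTI.
apply: (measurable_fun_ltr (measurable_cst _) _ measurableT (Y := [set true])) => //.
apply: measurable_funM; first exact: measurable_cst.
apply: measurable_sum => i; apply: measurable_sum => j.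
apply: measurable_funM; first by apply: measurable_funX; exact: measurable_cmod.
apply: measurable_fun_ifT; [|exact: measurable_cst|exact: measurable_cst].
apply: measurable_fun_ltr; first exact: measurable_cst.
exact: measurable_cmod.
Qed.

(** A coordinate above the threshold forces the modulus of its entry above it, so truncation costs
    at most the truncated moment. Rounding costs [r ^ 2] for each real and imaginary part. *)
Lemma sum_rounding_error (e a r : R) (V : finType) (code : R -> V) (val : V -> R) w :
  (forall x, `|x| <= e * a -> `|x - val (code x)| <= r) ->
  (forall x, e * a < `|x| -> val (code x) = 0) ->
  n%:R ^- 2 * \sum_k (coords (X n w) k - val (code (coords (X n w) k))) ^+ 2 <=
  truncated_moment e a w + 2 * r ^+ 2.
Proof.
move=> small large.
have err x : (x - val (code x)) ^+ 2 <= (if e * a < `|x| then x ^+ 2 else 0) + r ^+ 2.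
  case: ltP => xb; first by rewrite large// subr0 lerDl sqr_ge0.
  rewrite add0r -real_normK ?num_real// ler_sqr ?nnegrE ?small//.
  by rewrite (le_trans _ (small _ xb)).
have cmod2 z : cmod z ^+ 2 = complex.Re z ^+ 2 + complex.Im z ^+ 2 :> R.
  by rewrite sqr_sqrtr// addr_ge0 ?sqr_ge0.
have part_le (z : R[i]) (x : R) : x ^+ 2 <= cmod z ^+ 2 -> `|x| <= cmod z.
  by move=> h; rewrite -ler_sqr ?nnegrE ?sqrtr_ge0// real_normK ?num_real.
have -> : truncated_moment e a w + 2 * r ^+ 2 = n%:R ^- 2 * \sum_(i < n) \sum_(j < n)
    (cmod (X n w i j) ^+ 2 * (if e * a < cmod (X n w i j) then 1 else 0) + 2 * r ^+ 2).
  have E : n%:R ^- 2 * \sum_(i < n) \sum_(j < n) 2 * r ^+ 2 = 2 * r ^+ 2.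
    rewrite !sumr_const !card_ord -mulrnA -[X in _ * X]mulr_natr natrM.
    by field; rewrite pnatr_eq0 -lt0n.
  rewrite -[X in _ + X = _]E /truncated_moment -mulrDr -big_split; congr (_ * _).
  by apply: eq_bigr => i _; rewrite -big_split.
rewrite ler_wpM2l ?invr_ge0 ?exprn_ge0// sum_entry.
apply: ler_sum => i _; apply: ler_sum => j _; rewrite /coords/=.
set z := X n w i j.
have := err (complex.Re z); have := err (complex.Im z).
have zR : `|complex.Re z| <= cmod z by apply: part_le; rewrite cmod2 lerDl sqr_ge0.
have zI : `|complex.Im z| <= cmod z by apply: part_le; rewrite cmod2 lerDr sqr_ge0.
rewrite cmod2; set x := complex.Re z in zR *; set y := complex.Im z in zI *.
have := sqr_ge0 x; have := sqr_ge0 y.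
have [hz|hz] := ltP (e * a) (cmod z).
  by case: ifP => _; case: ifP => _; lra.
rewrite !ltNge (le_trans zR hz) (le_trans zI hz)/=; lra.
Qed.

End EsdMeasurable.

(** * Concentration at a fixed dimension *)

Lemma card_block n K (part : 'I_n -> 'I_n -> 'I_K) (dd : nat) (r : 'I_K) :
  (#|[set ij : 'I_n * 'I_n | part ij.1 ij.2 == r]| <= dd)%N ->
  (#|[pred k : entry n | block part k == r]| <= dd * 2)%N.
Proof.
(* Each matrix entry has a real and an imaginary coordinate. *)
move=> h; apply: leq_trans (leq_mul h (leqnn 2)).
rewrite -card_bool -cardX; apply: subset_leq_card; apply/fintype.subsetP => -[ij c].
by rewrite !inE /= andbT => kr; apply: mem_set.
Qed.

Lemma lipschitz_compact_norm_le (R : realType) (f : R -> R) (b : R) :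
  (forall x y, `|f x - f y| <= `|x - y|) -> (forall x, b <= `|x| -> f x = 0) ->
  0 <= b -> forall x, `|f x| <= 2 * b.
Proof.
move=> fL fb b0 x; have [bx|xb] := leP b `|x|; first by rewrite fb// normr0 mulr_ge0.
have fb0 : f b = 0 by apply: fb; exact: ler_norm.
rewrite -[f x]subr0 -fb0 (le_trans (fL _ _))// (le_trans (ler_normB _ _))//.
by rewrite (ger0_norm b0) mulr_natl mulr2n lerD2r ltW.
Qed.

Lemma esd_int_abs_esd_comb_close (R : realType) (n : nat) (f : R -> R) (c g r : R)
    (l : seq (R * R)) (x y : entry n -> R) : (0 < n)%N ->
  (forall x, `|f x - abs_comb c l x| <= g) ->
  n%:R ^- 2 * \sum_k (x k - y k) ^+ 2 <= r ->
  `|esd_int f (herm_of x) - abs_esd_comb c l y| <= g + total_weight l * Num.sqrt r.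
Proof.
move=> n0 fcl xy; apply: le_trans (ler_distD (abs_esd_comb c l x) _ _) _.
apply: lerD.
  by rewrite -esd_int_abs_comb//; apply: esd_int_close => //; exact: herm_of_herm.
have r0 : 0 <= r.
  by rewrite (le_trans _ xy)// mulr_ge0 ?invr_ge0 ?exprn_ge0// sumr_ge0// => k _; exact: sqr_ge0.
rewrite -ler_sqr ?nnegrE ?mulr_ge0 ?total_weight_ge0 ?sqrtr_ge0//.
rewrite real_normK ?num_real// (le_trans (abs_esd_comb_lipschitz n0 _ _ _ _))//.
by rewrite exprMn sqr_sqrtr// ler_wpM2l// sqr_ge0.
Qed.

(** The centre [m] is the mean of the discretised statistic and does not depend on [t]. A large
    deviation needs a large truncated moment or a deviation of the discretised statistic beyond
    [t]. *)
Lemma esd_stat_concentration d (T : measurableType d) (R : realType) (P : probability T R)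
    (X : forall n : nat, T -> 'M[R[i]]_n) (n dd : nat) (f : R -> R) (b c g e a : R)
    (l : seq (R * R)) :
  (0 < n)%N -> (forall w, herm_mx (X n w)) ->
  (forall i j : 'I_n, measurable_fun setT (fun w => complex.Re (X n w i j)) /\
                      measurable_fun setT (fun w => complex.Im (X n w i j))) ->
  property_S P (X n) dd ->
  (forall x y, `|f x - f y| <= `|x - y|) -> (forall x, b <= `|x| -> f x = 0) -> 0 <= b ->
  (forall x, `|f x - abs_comb c l x| <= g) -> 0 < e -> 0 < a ->
  exists2 m : R, `|m| <= 2 * b + g & forall t, 0 < t ->
    (P [set w | (t + g + total_weight l * Num.sqrt (2 * e) < `|esd_stat f X n w - m|)%R] <=
     P [set w | (e < truncated_moment X n e a w)%R] +
     (t ^- 2 * (total_weight l ^+ 2 * (4 * (e * a) ^+ 2 * (dd * 2)%:R * n%:R ^- 2)))%:E)%E.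
Proof.
move=> n0 hX mX [K [part [hdd indep]]] fL fb b0 fcl e0 a0.
have ea0 : 0 <= e * a by rewrite mulr_ge0 ?ltW.
(* Chosen so that the rounding part [2 * r ^ 2] of the error is at most [e]. *)
pose r := Num.min 1 (e / 2).
have r0 : 0 < r by rewrite lt_min ltr01 divr_gt0.
have r2 : 2 * r ^+ 2 <= e.
  rewrite -ler_pdivlMl// mulrC (le_trans _ (_ : r <= _))//.
    by rewrite expr2 ler_piMr ?(ltW r0)// ge_min lexx.
  by rewrite ge_min lexx orbT.
have [V [code [val [mc valb small large]]]] := finite_rounding ea0 r0.
pose p := block_law P (X n) part code.
have p0 : forall r v, 0 <= p r v := block_law_ge0 P (X n) part code.
have p1 : forall r, \sum_v p r v = 1 := block_law_sum1 P part mX mc.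
pose v (k : entry n) (u : {ffun entry n -> V}) := val (u k).
pose G (y : {ffun 'I_K -> {ffun entry n -> V}}) :=
  abs_esd_comb c l (fun k => v k (y (block part k))).
have Gb y : `|G y| <= 2 * b + g.
  rewrite /G -esd_int_abs_comb//; set x := fun k => _.
  have := esd_int_close n0 (herm_of_herm x) fcl; rewrite distrC => h.
  rewrite -[esd_int (abs_comb c l) _](subrK (esd_int f (herm_of x))) addrC.
  rewrite (le_trans (ler_normD _ _))// lerD//.
  by apply: esd_int_norm_le => //; [exact: herm_of_herm|exact: lipschitz_compact_norm_le].
exists (mean p G).
  rewrite ler_norml; apply/andP; split.
    rewrite -(mean_cst p1 (- (2 * b + g))); apply: mean_le => // y.
    by have := Gb y; rewrite ler_norml => /andP[].
  rewrite -(mean_cst p1 (2 * b + g)); apply: mean_le => // y.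
  by have := Gb y; rewrite ler_norml => /andP[].
move=> t t0; set W := total_weight l.
have mZ := measurable_esd_stat n0 hX mX fL fb b0.
have mcodes := measurable_codes part mX mc.
set bad := [set w | (e < truncated_moment X n e a w)%R].
have mbad : measurable bad := measurable_truncated_moment mX e a.
set dev := [set w | t < `|G (codes (X n) part code w) - mean p G|].
have mdev : measurable dev.
  exact: (measurable_finite_preimage mcodes [set y | t < `|G y - mean p G|]).
have Pdev : (P dev <= (t ^- 2 * (W ^+ 2 *
    (4 * (e * a) ^+ 2 * (dd * 2)%:R * n%:R ^- 2)))%:E)%E.
  apply: le_trans (codes_chebyshev mX mc indep G (mean p G) t0) _.
  rewrite lee_fin ler_wpM2l ?invr_ge0 ?sqr_ge0//.
  exact: (@abs_esd_comb_var _ _ _ _ _ c (e * a) l _ (block part) v G n0 p0 p1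
    (fun=> erefl) (fun j u => valb _) (fun s => card_block (hdd s))).
apply: le_trans (leeD2l _ Pdev).
apply: le_trans (measureU2 P mbad mdev); apply: le_measure; rewrite ?inE.
- rewrite -[X in measurable X]setTI.
  apply: (measurable_fun_ltr (measurable_cst _) _ measurableT (Y := [set true])) => //.
  by apply: measurableT_comp => //; exact: measurable_funB.
- exact: measurableU.
(* Outside both events the total squared error is at most [2 * e], and the triangle inequality
   contradicts the deviation. *)
move=> w /= hw; apply: contrapT => /not_orP[/negP + /negP].
rewrite -!leNgt => good small_dev; move: hw; apply/negP; rewrite -leNgt.
pose x := coords (X n w); pose x' k := val (code (x k)).
have GE : G (codes (X n) part code w) = abs_esd_comb c l x'.
  by rewrite /G; congr abs_esd_comb; apply: funext => k; rewrite /v /codes !ffunE eqxx.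
have err : n%:R ^- 2 * \sum_k (x k - x' k) ^+ 2 <= 2 * e.
  apply: le_trans (sum_rounding_error X n0 w small large) _.
  by rewrite (mulr_natl e) mulr2n; exact: lerD.
have close := esd_int_abs_esd_comb_close n0 fcl err.
rewrite -(esd_statE hX f w) in close.
rewrite GE in small_dev; rewrite -addrA addrC.
apply: le_trans (ler_distD (abs_esd_comb c l x') _ _) _.
exact: lerD.
Qed.

(** * Choice of constants and the limit *)

Lemma exists_small_factor (R : realType) (A s : R) : 0 <= A -> 0 < s ->
  exists2 e : R, 0 < e <= 1 & e * A <= s.
Proof.
move=> A0 s0; have A1 : 0 < A + 1 by rewrite ltr_wpDl.
exists (Num.min 1 (s / (A + 1))).
  by rewrite lt_min ltr01 divr_gt0//= ge_min lexx.
apply: (@le_trans _ _ (s / (A + 1) * A)).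
  by rewrite ler_wpM2r// ge_min lexx orbT.
by rewrite mulrAC ler_pdivrMr// ler_wpM2l ?(ltW s0)// lerDl.
Qed.

Unset Implicit Arguments.

Theorem theorem2p12 (d : measure_display) (T : measurableType d) (R : realType)
  (P : probability T R) (a : nat -> R) (X : forall n : nat, T -> 'M[R[i]]_n)
  (dn : nat -> nat) :
  (forall n, 0 < a n) ->
  a @ \oo --> +oo ->
  (forall n w, herm_mx (X n w)) ->
  (forall n (i j : 'I_n), measurable_fun setT (fun w => complex.Re (X n w i j)) /\
                          measurable_fun setT (fun w => complex.Im (X n w i j))) ->
  (forall n, property_S P (X n) (dn n)) ->
  (exists C : R, exists N : nat, forall n : nat, (N <= n)%N ->
      (dn n)%:R <= C * (n%:R ^+ 2 / a n ^+ 2)) ->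
  property_L P X a ->
  forall f : R -> R,
    continuous f ->
    compact (closure (f @^-1` [set~ 0])) ->
    (forall x y : R, `|f x - f y| <= `|x - y|) ->
    forall eps : R, 0 < eps ->
      (fun n => P [set w | eps < `|esd_stat f X n w - fine ('E_P[esd_stat f X n])%E| ])
        @ \oo --> 0%E.
Proof.
move=> a0 _ hX mX hS [C [N hdn]] hL f _ fsupp fL eps eps0.
have [b b0 fb] := compact_support_bounded fsupp.
suff H (k : R) : 0 < k -> \forall n \near \oo,
    (P [set w | (eps < `|esd_stat f X n w - fine 'E_P[esd_stat f X n]|)%R] <= k%:E)%E.
  apply/fine_cvgP; split.
    near=> n; rewrite ge0_fin_numE//.
    by rewrite (le_lt_trans (_ : _ <= 1%:E)%E) ?ltry//; near: n; exact: H.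
  apply/cvgrPdist_le => k k0; near=> n; rewrite /= sub0r normrN ger0_norm ?fine_ge0//.
  have h : (P [set w | (eps < `|esd_stat f X n w - fine 'E_P[esd_stat f X n]|)%R] <= k%:E)%E.
    by near: n; exact: H.
  by rewrite -lee_fin fineK// ge0_fin_numE// (le_lt_trans h)// ltry.
move=> k0.
have fB := lipschitz_compact_norm_le fL fb b0.
set D := 4 * b + 1; have D0 : 0 < D by rewrite ltr_wpDl// mulr_ge0.
(* [D] bounds the distance of the statistic from [m], so an event of probability [k'] shifts the
   expectation by at most [eps / 4]. *)
pose k' := Num.min k (eps / (4 * D)).
have k'0 : 0 < k' by rewrite lt_min k0 divr_gt0// mulr_gt0.
have k'k : k' <= k by rewrite ge_min lexx.
have Dk' : D * k' <= eps / 4.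
  rewrite (le_trans (ler_wpM2l (ltW D0) (_ : k' <= eps / (4 * D))))//.
    by rewrite ge_min lexx orbT.
  by rewrite le_eqVlt; apply/orP; left; apply/eqP; field; exact: lt0r_neq0.
pose g := Num.min 1 (eps / 16).
have g0 : 0 < g by rewrite lt_min ltr01 divr_gt0.
have [c [l fcl]] := lipschitz_abs_comb_approx fL fb b0 g0.
set W := total_weight l; have W0 : 0 <= W := total_weight_ge0 l.
pose t := eps / 8; have t0 : 0 < t by rewrite divr_gt0.
(* [e * A1] is the square of the rounding term and [e * A2] bounds the Chebyshev term. The deviation
   budget is [eps / 8 + eps / 16 + eps / 16 = eps / 4]. *)
pose A1 := W ^+ 2 * 2; pose A2 := t ^- 2 * (W ^+ 2 * (8 * `|C|)).
have A10 : 0 <= A1 by rewrite mulr_ge0// sqr_ge0.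
have A20 : 0 <= A2.
  by rewrite mulr_ge0// ?invr_ge0 ?sqr_ge0// mulr_ge0// ?sqr_ge0// mulr_ge0.
pose s := Num.min ((eps / 16) ^+ 2) (k' / 2).
have s0 : 0 < s by rewrite lt_min exprn_gt0 ?divr_gt0.
have [e /andP[e0 e1] eA] := exists_small_factor (addr_ge0 A10 A20) s0.
have e_small : W * Num.sqrt (2 * e) <= eps / 16.
  rewrite -ler_sqr ?nnegrE ?mulr_ge0 ?sqrtr_ge0 ?invr_ge0 ?(ltW eps0)//.
  rewrite exprMn sqr_sqrtr ?mulr_ge0 ?(ltW e0)//.
  apply: (@le_trans _ _ (e * (A1 + A2))).
    by rewrite mulrA mulrC ler_wpM2l ?(ltW e0)// lerDl.
  by rewrite (le_trans eA)// ge_min lexx.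
have e_var : e * A2 <= k' / 2.
  apply: (@le_trans _ _ (e * (A1 + A2))); first by rewrite ler_wpM2l ?(ltW e0)// lerDr.
  by rewrite (le_trans eA)// ge_min lexx orbT.
have /fine_cvgP[Lfin /cvgrPdist_le Lcvg] :
    P [set w | (e < truncated_moment X n e (a n) w)%R] @[n --> \oo] --> (0 : R)%:E.
  apply: limn_esup_le_cvg => //.
  by have := hL e e0; rewrite -/(truncated_moment _ _ _ _ _) => ->.
have k'20 : 0 < k' / 2 by rewrite divr_gt0.
near=> n.
have n0 : (0 < n)%N by near: n; exact: nbhs_infty_gt.
have Pbad : (P [set w | (e < truncated_moment X n e (a n) w)%R] <= (k' / 2)%:E)%E.
  have h1 : P [set w | (e < truncated_moment X n e (a n) w)%R] \is a fin_num.
    by near: n; exact: Lfin.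
  rewrite -(fineK h1) lee_fin -[leLHS]ger0_norm ?fine_ge0// -normrN -sub0r.
  by near: n; exact: Lcvg.
have dnC : (dn n)%:R <= `|C| * (n%:R ^+ 2 / a n ^+ 2).
  have : (dn n)%:R <= C * (n%:R ^+ 2 / a n ^+ 2).
    by apply: hdn; near: n; exact: nbhs_infty_ge.
  move=> h; apply: (le_trans h); rewrite ler_wpM2r ?ler_norm//.
  by rewrite divr_ge0 ?exprn_ge0// ltW.
(* The bound on [dn n] cancels [a n ^ 2] and [n ^ 2], leaving [e ^ 2] times a constant; [e <= 1]
   reduces this to [e]. *)
have Pvar : t ^- 2 * (W ^+ 2 * (4 * (e * a n) ^+ 2 * (dn n * 2)%:R * n%:R ^- 2)) <= k' / 2.
  apply: le_trans e_var.
  have nR : (n%:R : R) != 0 by rewrite pnatr_eq0 -lt0n.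
  have aR : a n != 0 by exact: lt0r_neq0.
  have -> : e * A2 = t ^- 2 * (W ^+ 2 * (e * (8 * `|C|))).
    by rewrite /A2 mulrCA (mulrCA e (W ^+ 2)).
  rewrite ler_wpM2l ?invr_ge0 ?exprn_ge0 ?(ltW t0)// ler_wpM2l ?sqr_ge0//.
  apply: (@le_trans _ _ (e ^+ 2 * (8 * `|C|))); last first.
    by rewrite ler_wpM2r ?mulr_ge0// expr2 ler_piMr// ltW.
  have -> : 4 * (e * a n) ^+ 2 * (dn n * 2)%:R * n%:R ^- 2 =
      e ^+ 2 * (8 * (a n ^+ 2 / n%:R ^+ 2)) * (dn n)%:R :> R.
    by rewrite natrM; field.
  apply: (@le_trans _ _ (e ^+ 2 * (8 * (a n ^+ 2 / n%:R ^+ 2)) *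
      (`|C| * (n%:R ^+ 2 / a n ^+ 2)))).
    rewrite ler_wpM2l// mulr_ge0 ?sqr_ge0// mulr_ge0// divr_ge0// ?exprn_ge0//.
    exact: ltW.
  by rewrite le_eqVlt; apply/orP; left; apply/eqP; field; rewrite nR aR.
have [m mb Pm] := esd_stat_concentration n0 (hX n) (mX n) (hS n)
  fL fb b0 fcl e0 (a0 n).
have g1 : g <= 1 by rewrite ge_min lexx.
have g16 : g <= eps / 16 by rewrite ge_min lexx orbT.
have mZ := measurable_esd_stat n0 (hX n) (mX n) fL fb b0.
set Z := esd_stat f X n in mZ Pm *.
have msub (u x : R) : measurable [set w | u < `|Z w - x|].
  rewrite -[Y in measurable Y]setTI.
  apply: (measurable_fun_ltr (measurable_cst _) _ measurableT (Y := [set true])) => //.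
  by apply: measurableT_comp => //; exact: measurable_funB.
have Pdev : (P [set w | (eps / 4 < `|Z w - m|)%R] <= k'%:E)%E.
  apply: (@le_trans _ _ (P [set w | (t + g + W * Num.sqrt (2 * e) < `|Z w - m|)%R])).
    apply: le_measure; rewrite ?inE//; try exact: msub.
    move=> w /=; apply: le_lt_trans.
    have -> : eps / 4 = t + eps / 16 + eps / 16 by rewrite /t; field.
    by rewrite lerD// lerD2l.
  apply: (le_trans (Pm t t0)).
  have -> : k' = k' / 2 + k' / 2 by field.
  by rewrite EFinD leeD// lee_fin.
have ZD w : `|Z w - m| <= D.
  rewrite (le_trans (ler_normB _ _))//.
  apply: (@le_trans _ _ (2 * b + (2 * b + 1))).
    rewrite lerD//.
      by rewrite /Z esd_statE//; apply: esd_int_norm_le => //; exact: herm_of_herm.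
    by rewrite (le_trans mb)// lerD2l.
  by rewrite /D; lra.
have eps4 : 0 <= eps / 4 by rewrite divr_ge0// ltW.
(* The expectation is within [eps / 2] of [m], so a deviation above [eps] from it forces one above
   [eps / 4] from [m]. *)
have Em := expectation_close mZ ZD eps4 Pdev.
apply: (@le_trans _ _ k'%:E); last by rewrite lee_fin.
apply: le_trans Pdev; apply: le_measure; rewrite ?inE//; try exact: msub.
move=> w /= hw; have := ler_distD m (Z w) (fine 'E_P[Z]); rewrite (distrC m).
set p := `|Z w - m|; move: hw Em; set q := `|_ - m|; set r := `|_|.
move: (D * k') Dk' eps0 => dk; clear; lra.
Unshelve. all: by end_near. Qed.
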